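(* Let $F$ be an algebraically closed field of characteristic zero, let $G$ be a finite group, let $A$ be a finite dimensional associative $G$-graded algebra over $F$, and let $K$ be any subgroup of $G$. Let $A_K=\bigoplus_{g\in K}A_g$, viewed as a $K$-graded algebra. Then $$\exp^{Conj}_{G}(A)\leq [G:K]^2\,\exp^{Conj}_{K}(A_K).$$
   Context: Definition of $\exp^{Conj}_G(A)$, for a finite group $G$ and a finite dimensional $G$-graded associative algebra $A$ over an algebraically closed field $F$ of characteristic zero: the Jacobson radical $J$ of $A$ is a $G$-graded ideal, and there is a $G$-graded semisimple subalgebra $S_G$ of $A$ with $A=S_G\oplus J$ as vector spaces (known results; fix such an $S_G$, the quantity below not depending on the choice). Let $S_G=(S_G)_1\oplus\cdots\oplus(S_G)_q$ be the decomposition of $S_G$ into its $G$-simple components (a $G$-simple algebra is a $G$-graded algebra with nonzero multiplication and no nontrivial $G$-graded two-sided ideals). Consider all nonzero products in $A$ of the form $(S_G)_{i_1}J(S_G)_{i_2}J\cdots J(S_G)_{i_k}$, $k\geq 1$ (for $k=1$ the product is just $(S_G)_{i_1}$; the indices may repeat). To each such nonzero product assign the sum of the $F$-dimensions of the different $G$-simple components appearing in it, each counted once. Then $\exp^{Conj}_G(A)$ is the maximum of these sums (and $0$ if $S_G=0$). The quantity $\exp^{Conj}_K(A_K)$ is defined in the same way for the $K$-graded algebra $A_K$, with its own Jacobson radical and $K$-simple components. *)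

(* Defs.v *)
From HB Require Import structures.
From mathcomp Require Import all_boot all_order all_algebra all_fingroup.
From mathcomp Require Import sesquilinear.
From mathcomp Require Import boolp classical_sets.

Set Implicit Arguments.
Unset Strict Implicit.
Unset Printing Implicit Defensive.

Import GRing.Theory.
Local Open Scope ring_scope.

(* Algebras are associative but not assumed to have a unit (mathcomp's
   falgType is unital): an algebra is a vectType A with a bilinear
   multiplication m. Subalgebras, ideals and graded subspaces are all
   subspaces of one ambient algebra A, and the notions below are relative to a
   subalgebra B. *)
Section Algebra.

Variables (F : fieldType) (A : vectType F) (m : {bilinear A -> A -> A}).
Implicit Types (B I J S T U V : {vspace A}) (x y z : A).

(* The span of all products, as in mathcomp's falgebra. *)
Definition mulv U V : {vspace A} :=
  <<[seq m u v | u <- vbasis U, v <- vbasis V]>>%VS.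

Definition subalgebra B : Prop := (mulv B B <= B)%VS.

Definition ideal_of B I : Prop :=
  [/\ (I <= B)%VS, (mulv B I <= I)%VS & (mulv I B <= I)%VS].

(* (1 - z)(1 - y) = 1, written without a unit. *)
Definition left_quasi_regular B y : Prop :=
  exists2 z, z \in B & z + y = m z y.

(* The Jacobson radical of a possibly non-unital ring B is the set of those x
   for which all elements of the left ideal B x are left quasi-regular. *)
Definition in_jacobson B x : Prop :=
  x \in B /\ (forall b, b \in B -> left_quasi_regular B (m b x)).

(* The radical as a subspace; lemma jacobsonP below shows that the default
   value is not used. *)
Definition jacobson B : {vspace A} :=
  xget 0%VS [set J : {vspace A} | forall x, x \in J <-> in_jacobson B x].

Definition semisimple B : Prop := jacobson B = 0%VS.

End Algebra.

Section Graded.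

Variables (F : fieldType) (A : vectType F) (m : {bilinear A -> A -> A}).
Variables (gT : finGroupType) (gr : gT -> {vspace A}).
Implicit Types (H : {group gT}) (B I J S T U : {vspace A}).

Definition is_grading : Prop :=
  [/\ directv (\sum_(g : gT) gr g)%VS,
      (\sum_(g : gT) gr g)%VS = fullv
    & forall g h : gT, (mulv m (gr g) (gr h) <= gr (g * h)%g)%VS].

Definition graded_part H : {vspace A} := (\sum_(g in H) gr g)%VS.

Definition graded H U : Prop := U = (\sum_(g in H) (U :&: gr g))%VS.

Definition graded_simple H T : Prop :=
  [/\ subalgebra m T, graded H T, mulv m T T <> 0%VS
    & forall I, ideal_of m T I -> graded H I -> I = 0%VS \/ I = T].

Definition graded_wedderburn_malcev H B S : Prop :=
  [/\ subalgebra m S, graded H S, semisimple m S,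
      (S + jacobson m B)%VS = B & (S :&: jacobson m B)%VS = 0%VS].

Definition component (Ts : seq {vspace A}) (i : nat) : {vspace A} :=
  nth 0%VS Ts i.

Definition graded_simple_decomposition H S (Ts : seq {vspace A}) : Prop :=
  [/\ (\sum_(i < size Ts) component Ts i)%VS = S,
      directv (\sum_(i < size Ts) component Ts i)%VS
    & forall i : 'I_(size Ts),
        ideal_of m S (component Ts i) /\ graded_simple H (component Ts i)].

(* T_i J T_j1 J T_j2 J ... J T_jr, for w = [:: j1; j2; ...; jr]. *)
Definition component_product J (Ts : seq {vspace A}) (i : 'I_(size Ts))
    (w : seq 'I_(size Ts)) : {vspace A} :=
  foldl (fun U (j : 'I_(size Ts)) => mulv m (mulv m U J) (component Ts j))
    (component Ts i) w.

Arguments component_product : clear implicits.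

(* X is the set of (indices of) components appearing in a nonzero product. *)
Definition appear_together J (Ts : seq {vspace A})
    (X : {set 'I_(size Ts)}) : Prop :=
  exists i w, component_product J Ts i w <> 0%VS /\ X = [set j in i :: w].

Definition exp_of_components J (Ts : seq {vspace A}) : nat :=
  \max_(X : {set 'I_(size Ts)} | `[< appear_together J X >])
     \sum_(i in X) \dim (component Ts i).

(* exp^Conj_H of the H-graded algebra B. The choices of S and of the
   (enumeration of the) decomposition Ts are those in the definition of the
   invariant; both exist by the graded Wedderburn-Malcev theorem and by
   graded semisimplicity. *)
Definition exp_conj H B : nat :=
  let S := xget 0%VS [set S | graded_wedderburn_malcev H B S] in
  let Ts := xget [::] [set Ts | graded_simple_decomposition H S Ts] in
  exp_of_components (jacobson m B) Ts.

End Graded.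

Section JacobsonSubspace.

Variables (F : fieldType) (A : vectType F) (m : {bilinear A -> A -> A}).
Hypothesis mA : associative m.

Lemma linear_pred_vspace (P : A -> Prop) :
  P 0 -> (forall (a : F) x y, P x -> P y -> P (a *: x + y)) ->
  exists U : {vspace A}, forall x, x \in U <-> P x.
Proof.
move=> P0 PL.
suff ext n (U : {vspace A}) : (forall x, x \in U -> P x) ->
    (\dim {:A} - \dim U <= n)%N ->
    exists V : {vspace A}, forall x, x \in V <-> P x.
  by apply: (ext _ 0%VS _ (leqnn _)) => x; rewrite memv0 => /eqP ->.
elim: n U => [|n IHn] U UP dU.
  exists U => x; split=> [/UP //|_].
  have/eqP -> : U == fullv by rewrite eqEdim subvf -subn_eq0 -leqn0.
  exact: memvf.
have [[x [Px xU]]|nox] := pselect (exists x, P x /\ x \notin U); last first.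
  exists U => x; split=> [/UP //|Px].
  by apply: contrapT => /negP xU; apply: nox; exists x.
apply: (IHn (<[x]> + U)%VS).
  move=> _ /memv_addP[_ /vlineP[a ->] [v /UP Pv ->]]; exact: PL.
have dlt : (\dim U < \dim (<[x]> + U))%N.
  rewrite ltnNge; apply: contra xU => le.
  have /eqP -> : U == (<[x]> + U)%VS by rewrite eqEdim addvSr.
  by rewrite (subvP (addvSl _ _)) ?memv_line.
have dle : (\dim (<[x]> + U) <= \dim {:A})%N by rewrite dimvS ?subvf.
rewrite -ltnS (leq_trans _ dU) // ltn_sub2l //.
exact: leq_trans dlt dle.
Qed.

Lemma mem_mulv (U V : {vspace A}) u v :
  u \in U -> v \in V -> m u v \in mulv m U V.
Proof.
move=> /coord_vbasis -> /coord_vbasis ->.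
rewrite linear_sumlz; apply: memv_suml => i _.
rewrite linear_sumr; apply: memv_suml => j _.
rewrite linearZl linearZr /= !rpredZ // memv_span //.
by apply/allpairsP; exists ((vbasis U)`_i, (vbasis V)`_j);
  rewrite !mem_nth ?size_tuple.
Qed.

Lemma jacobsonP (B : {vspace A}) :
  subalgebra m B -> forall x, x \in jacobson m B <-> in_jacobson m B x.
Proof.
move=> mB.
have BM u v : u \in B -> v \in B -> m u v \in B.
  by move=> uB vB; rewrite (subvP mB) ?mem_mulv.
rewrite /jacobson.
suff ex : exists J : {vspace A}, forall x, x \in J <-> in_jacobson m B x.
  exact: (xgetPex 0%VS ex).
apply: linear_pred_vspace => [|a x y [xB xJ] [yB yJ]].
  split=> [|b _]; rewrite ?mem0v //; exists 0; first exact: mem0v.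
  by rewrite linear0r linear0l addr0.
split=> [|b bB]; first by rewrite memvD ?memvZ.
have [z zB ez] := xJ (a *: b) (memvZ _ bB).
have [z' z'B ez'] := yJ (b - m z b) (memvB bB (BM _ _ zB bB)).
have -> : m b (a *: x + y) = m (a *: b) x + m b y.
  by rewrite linearDr linearZr_LR linearZl_LR.
move: ez ez'; rewrite linearBl -mA linearBr.
set u := m (a *: b) x; set v := m b y => ez ez'.
exists (z + z' - m z' z); first by rewrite memvB ?memvD ?BM.
have ez2 := congr1 (m z') ez; rewrite linearDr in ez2.
rewrite linearBl linearDl -!mA !linearDr -ez2 -ez.
have -> : m z' v = z' + (v - m z v) + m z' (m z v) by rewrite ez' subrK.
rewrite !opprD !addrA.
rewrite [RHS](ACl (1*5*9*2*6*(3*7)*(4*10)*(8*11)))%AC /=.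
by rewrite !subrr !addr0.
Qed.

End JacobsonSubspace.

(* Main.v *)
From HB Require Import structures.
Require Import Defs.
From mathcomp Require Import all_boot all_order all_algebra all_fingroup.
From mathcomp Require Import sesquilinear.
From mathcomp Require Import boolp.
From mathcomp Require classical_sets.

Set Implicit Arguments.
Unset Strict Implicit.
Unset Printing Implicit Defensive.

Import GRing.Theory passmx.
Local Open Scope ring_scope.

(** Let J be the radical of A, S a graded semisimple complement of J, and
    S_1, ..., S_q its G-simple components; write A_K for the K-part of A.

    The trace form. In characteristic 0 the radical of a subalgebra B is the
    set of those x in B for which b x has trace 0 on A for every b in B
    ([jacobson_traceP]): a non-nilpotent element has a nonzero idempotent
    multiple, whose trace is its rank. Homogeneous elements of degree other
    than 1 permute the graded pieces of A without fixed piece, so they have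
    trace 0 ([rtrace_gr]). Hence radicals of graded subalgebras are graded, and
    the radical of A_K is the K-part of J ([jacobson_gpart]); so the K-part of S
    is a graded semisimple complement in A_K
    ([graded_wedderburn_malcev_subgroup]). Orthogonal complements for the trace
    form split a graded semisimple algebra into graded simple ideals
    ([graded_ideal_decomposition]). Thus the choices that enter exp(A_K) exist.

    One component. A G-simple R contains an idempotent f of degree 1 for which
    f R is a minimal graded right ideal ([exists_graded_primitive]). Then
    D = f R f is a graded division algebra. For h in G put V_h = f R_(hK) and
    W_h = R_(K h^-1) f. Counting D-independent homogeneous elements gives
    dim(V_h)^2 <= dim D dim(W_h V_h) and dim D dim R <= (dim f R)^2
    ([corner_dim_lower], [corner_dim_upper]). As V_h is either zero or graded
    irreducible over the K-part of R, the ideal W_h V_h is modulo the radical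
    exactly one K-simple component T_(R,h) of whatever complement of the radical
    of A_K was chosen ([component_correspondence]). Since the dimensions of the
    V_h, for h in G, add up to |K| dim f R, the Cauchy-Schwarz inequality yields
    |K| dim R <= [G:K] times the sum over h in G of dim T_(R,h), where a term with
    V_h = 0 counts as 0 ([dim_component_linked]).

    Chains. A nonzero product S_i1 J ... J S_ik yields a nonzero product
    f_i1 x_1 f_i2 x_2 ... f_ik with homogeneous x_a in J
    ([component_product_path]). Let d_a be the degree of the part of it that
    precedes f_ia. Fix g in G. The components T attached to S_ia and the coset
    d_a^-1 g K can be inserted at all places a where V is nonzero; the elements
    between two consecutive places then have degree in K, so these components
    occur together in a nonzero product for A_K ([realized_path]). Different S_i
    give different components ([tau_inj]). Hence for each g the dimensions of the
    components found in this way add up to at most exp(A_K), and summing over g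
    in G gives the inequality ([dim_appear_together]): the first factor [G:K]
    comes from Cauchy-Schwarz, the second one from this average. *)

(** * The trace form of the regular representation *)

Lemma mxtrace_idempotent (F : fieldType) n (E : 'M[F]_n) :
  E *m E = E -> \tr E = (\rank E)%:R.
Proof.
move=> EE; rewrite -{1}(mulmx_base E) mxtrace_mulC.
suff -> : row_base E *m col_base E = 1%:M by rewrite mxtrace1.
apply: (row_full_inj (col_base_full E)); apply: (row_free_inj (row_base_free E)).
by rewrite /= mulmx1 mulmxA -mulmxA !mulmx_base.
Qed.

(** All roots of the characteristic polynomial are 0, so it is a power of X. *)
Lemma mxtrace_noneigen (F : closedFieldType) n (M : 'M[F]_n) :
  (forall a, eigenvalue M a -> a = 0) -> \tr M = 0.
Proof.
case: n M => [|n] M M0; first by rewrite /mxtrace big_ord0.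
have [r Dp] := closed_field_poly_normal (char_poly M).
rewrite (monicP (char_poly_monic M)) scale1r in Dp.
have r0 : r = nseq n.+1 0.
  have <- : size r = n.+1.
    by apply: succn_inj; rewrite -(size_char_poly M) Dp size_prod_XsubC.
  apply/all_pred1P/allP => z zr; apply/eqP/M0.
  by rewrite eigenvalue_root_char Dp root_prod_XsubC.
apply/eqP; rewrite -oppr_eq0 -char_poly_trace // Dp r0 big_nseq subr0.
have -> : iter n.+1 ( *%R 'X) 1 = 'X^(n.+1) :> {poly F} by rewrite iter_mulr_1.
by rewrite coefXn ltn_eqF.
Qed.

Section Trace.
Variables (F : fieldType) (V : vectType F).
Local Notation e := (vbasis {:V}).
Definition lftrace (f : 'End(V)) : F := \tr (mxof e e f).
Lemma lftrace_linear : scalar lftrace.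
Proof. by move=> a f g; rewrite /lftrace linearP /= mxtraceD mxtraceZ. Qed.
HB.instance Definition _ :=
  GRing.isSemilinear.Build F _ _ _ lftrace (GRing.semilinear_linear lftrace_linear).

Lemma lftraceC (f g : 'End(V)) : lftrace (f \o g)%VF = lftrace (g \o f)%VF.
Proof. by rewrite /lftrace !(mxof_comp _ _ (vbasisP _)) mxtrace_mulC. Qed.
End Trace.

Lemma lftrace_idempotent (F : fieldType) (V : vectType F) (f : 'End(V)) :
  [pchar F] =i pred0 -> (f \o f)%VF = f -> f != 0 -> lftrace f != 0.
Proof.
move=> charF0 ff f0; rewrite /lftrace mxtrace_idempotent; last by rewrite -(mxof_comp _ _ (vbasisP _)) ff.
by rewrite ((pcharf0P F).1 charF0) mxrank_eq0 mxof_eq0 ?vbasisP.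
Qed.

Lemma lftrace_noneigen (F : closedFieldType) (V : vectType F) (f : 'End(V)) :
  (forall a v, f v = a *: v -> v != 0 -> a = 0) -> lftrace f = 0.
Proof.
move=> f0; apply: mxtrace_noneigen => a /eigenvalueP[v].
rewrite mul_mxof => Dv v0; apply: (f0 a (vecof (vbasis fullv) v)); last first.
  by rewrite vecof_eq0 ?vbasisP.
by rewrite -(rVofK (vbasisP _) (f _)) Dv linearZ.
Qed.

Section Multiplication.
Variables (F : fieldType) (A : vectType F) (m : {bilinear A -> A -> A}).
Hypothesis mA : associative m.
Local Notation "x ** y" := (m x y) (at level 40, left associativity).
Implicit Types (B I J S T U V W : {vspace A}) (x y z : A).

Lemma mulv_subP U V W :
  (mulv m U V <= W)%VS <-> (forall u v, u \in U -> v \in V -> u ** v \in W).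
Proof.
split=> [/subvP sW u v uU vV | UVW]; first by rewrite sW ?mem_mulv.
apply/span_subvP => _ /allpairsP[[u v] /= [uU vV ->]].
by apply: UVW; apply: vbasis_mem.
Qed.

Lemma ideal_ofM B I : ideal_of m B I -> forall b x, b \in B -> x \in I ->
  [/\ x \in B, b ** x \in I & x ** b \in I].
Proof.
move=> [sI lI rI] b x bB xI.
by split; [apply: (subvP sI) | apply: (subvP lI); apply: mem_mulv
  | apply: (subvP rI); apply: mem_mulv].
Qed.

Definition lmulv x : 'End(A) := linfun (m x).
Definition rmulv x : 'End(A) := linfun (applyr m x).
Lemma lmulvE x y : lmulv x y = x ** y. Proof. exact: lfunE. Qed.
Lemma rmulvE x y : rmulv x y = y ** x. Proof. exact: lfunE. Qed.

Lemma lmulv_linear : linear lmulv.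
Proof.
move=> a x y; apply/lfunP => z.
by rewrite add_lfunE scale_lfunE !lmulvE linearDl linearZl_LR.
Qed.
HB.instance Definition _ :=
  GRing.isSemilinear.Build F _ _ _ lmulv (GRing.semilinear_linear lmulv_linear).

Lemma lmulvM x y : lmulv (x ** y) = (lmulv x \o lmulv y)%VF.
Proof. by apply/lfunP => z; rewrite comp_lfunE !lmulvE mA. Qed.

Definition rtrace x : F := lftrace (lmulv x).
Lemma rtrace_linear : scalar rtrace.
Proof. by move=> a x y; rewrite /rtrace linearP linearP. Qed.
HB.instance Definition _ :=
  GRing.isSemilinear.Build F _ _ _ rtrace (GRing.semilinear_linear rtrace_linear).

Lemma rtraceC x y : rtrace (x ** y) = rtrace (y ** x).
Proof. by rewrite /rtrace !lmulvM lftraceC. Qed.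

Lemma rtrace_idempotent e :
  [pchar F] =i pred0 -> e ** e = e -> e != 0 -> rtrace e != 0.
Proof.
move=> charF0 ee e0; apply: lftrace_idempotent => //; first by rewrite -lmulvM ee.
by apply: contra_neq e0 => L0; rewrite -ee -lmulvE L0 zero_lfunE.
Qed.

Lemma subalgebraM B u v : subalgebra m B -> u \in B -> v \in B -> u ** v \in B.
Proof. by move=> mB uB vB; rewrite (subvP mB) ?mem_mulv. Qed.

Lemma iter_rmulv y k u : u ** iter k (rmulv y) y = iter k.+1 (rmulv y) u.
Proof.
elim: k u => [|k IHk] u; first by rewrite /= rmulvE.
by rewrite [iter k.+1 _ y]iterS [RHS]iterS -IHk !rmulvE mA.
Qed.

(** A power of y written as an iterate, since there is no unit to start from:
    iter n (rmulv y) y is y^(n+1). *)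
Definition nilpotent y := exists n, iter n (rmulv y) y = 0.

(** The chain of left ideals B y^n of B becomes stationary. If its limit U is
    nonzero, right multiplication by a high power z of y is bijective on U, and
    the e in U with e z = z is idempotent. *)
Lemma idempotent_or_nilpotent B y : subalgebra m B -> y \in B ->
  nilpotent y \/ exists2 b, b \in B & [/\ b ** y != 0 & (b ** y) ** (b ** y) = b ** y].
Proof.
move=> mB yB; set r := rmulv y.
have BM u v : u \in B -> v \in B -> u ** v \in B by exact: subalgebraM.
pose U n := iter n (lfun_img r) B.
have UB n : (U n <= B)%VS.
  elim: n => //= n IHn; apply/subvP => _ /memv_imgP[u /(subvP IHn) uB ->].
  by rewrite rmulvE BM.
have USn n : (U n.+1 <= U n)%VS.
  by elim: n => [|n IHn]; [exact: (UB 1%N) | exact: limgS].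
have [n Un] : exists n, U n.+1 = U n.
  apply: contrapT => noU.
  suff dU n : (\dim (U n) + n <= \dim B)%N.
    by have := dU (\dim B).+1; rewrite addnS ltnNge leq_addl.
  elim: n => [|n IHn]; first by rewrite addn0.
  apply: leq_trans IHn; rewrite addnS ltn_add2r ltnNge; apply/negP => le.
  by apply: noU; exists n; apply/eqP; rewrite eqEdim USn.
(* z is y^(n+1), which lies in U n = B y^n. *)
pose z := iter n r y.
have rM k u : u ** iter k r y = iter k.+1 r u by apply: iter_rmulv.
have zU : z \in U n.
  rewrite /z /U; elim: (n) => //= k IHk; exact: memv_img.
have Uk k u : u \in U n -> exists2 u', u' \in U n & iter k r u' = u.
  elim: k u => [|k IHk] u uU; first by exists u.
  have uU1 : u \in U n.+1 by rewrite Un.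
  have [u1 /IHk[u' u'U <-] ->] := memv_imgP uU1.
  by exists u'.
have Uz u : u \in U n -> exists2 u', u' \in U n & u' ** z = u.
  by case/(Uk n.+1) => u' u'U <-; exists u'; rewrite ?rM.
have z_inj u : u \in U n -> u ** z = 0 -> u = 0.
  move=> uU uz0; apply/eqP; rewrite -memv0.
  suff <- : (U n :&: lker (rmulv z))%VS = 0%VS.
    by rewrite memv_cap uU memv_ker rmulvE uz0 eqxx.
  apply/eqP; rewrite -dimv_eq0 -(eqn_add2r (\dim (rmulv z @: U n))) limg_ker_dim.
  rewrite add0n eqn_leq !dimvS //.
    apply/subvP => _ /memv_imgP[u1 u1U ->]; rewrite rmulvE rM.
    by elim: n.+1 => // k IHk; rewrite -[U n]Un; apply: memv_img.
  by apply/subvP => u1 /Uz[u' u'U <-]; rewrite -rmulvE memv_img.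
have [z0|z0] := eqVneq z 0; first by left; exists n.
right; have [e eU ez] := Uz z zU.
have eUn : e \in U n.+1 by rewrite Un.
have [b /(subvP (UB n)) bB] := memv_imgP eUn; rewrite rmulvE => De.
exists b => //; rewrite -De; split.
  by apply: contra_neq z0 => e0; rewrite -ez e0 linear0l.
apply/eqP; rewrite -subr_eq0; apply/eqP/z_inj; last first.
  by rewrite linearBl /= -mA ez ez subrr.
rewrite memvB // {1}De.
have UL k u v : u \in B -> v \in U k -> u ** v \in U k.
  elim: k v => [|k IHk] v uB; first exact: BM.
  case/memv_imgP=> v1 v1U ->; rewrite rmulvE mA -rmulvE memv_img //; exact: IHk.
by rewrite -De UL // (subvP (UB n)).
Qed.
End Multiplication.

(** * The radical through the trace form *)

Section Radical.
Variables (F : closedFieldType) (A : vectType F) (m : {bilinear A -> A -> A}).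
Hypothesis charF0 : [pchar F] =i pred0.
Hypothesis mA : associative m.
Local Notation "x ** y" := (m x y) (at level 40, left associativity).
Implicit Types (B I J S T U V W : {vspace A}) (x y z : A).

(** The equation z + y = z y says that z |-> z y - z takes the value y. On B this
    map is injective, because z = z y implies z = z y^n = 0; hence it is onto. *)
Lemma nilpotent_left_quasi_regular B y :
  subalgebra m B -> y \in B -> nilpotent m y -> left_quasi_regular m B y.
Proof.
move=> mB yB [n yn0]; pose g := (rmulv m y - \1)%VF.
have gE z : g z = z ** y - z by rewrite add_lfunE opp_lfunE id_lfunE rmulvE.
have gB : (g @: B)%VS = B.
  apply/eqP; rewrite eqEdim; apply/andP; split.
    apply/subvP => _ /memv_imgP[z zB ->].
    by rewrite gE memvB ?subalgebraM.
  rewrite limg_dim_eq //; apply/eqP; rewrite -subv0; apply/subvP => z.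
  rewrite memv_cap memv_ker gE subr_eq0 memv0 => /andP[_ /eqP zy].
  have zk k : iter k (rmulv m y) z = z by elim: k => //= k ->; rewrite rmulvE.
  by rewrite -(zk n.+1) -(iter_rmulv mA) yn0 linear0r.
have : y \in (g @: B)%VS by rewrite gB.
by case/memv_imgP => z zB; rewrite gE => Dy; exists z; rewrite // {1}Dy addrC subrK.
Qed.

(** If b x is left quasi-regular with all its scalar multiples, then it has no
    nonzero eigenvalue and hence no trace. Conversely, if b x is not nilpotent,
    it has a nonzero idempotent multiple c b x, whose trace is not 0. The trace is
    taken on A and not on B, which makes the radicals of different subalgebras
    comparable. *)
Lemma jacobson_traceP B x : subalgebra m B ->
  x \in jacobson m B <->
  x \in B /\ (forall b, b \in B -> rtrace m (b ** x) = 0).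
Proof.
move=> mB; split=> [/(jacobsonP mA mB)[xB xJ] | [xB x0]].
  split=> // b bB; apply: lftrace_noneigen => a v.
  rewrite lmulvE => Dv v0; apply/eqP; apply: contraT => a0.
  have [z zB] := xJ (a^-1 *: b) (memvZ _ bB).
  rewrite linearZl_LR; set y := a^-1 *: _ => Dz.
  have yv : y ** v = v by rewrite linearZl_LR Dv scalerA mulVf // scale1r.
  have := congr1 (m^~ v) Dz; rewrite /= linearDl -mA yv -[RHS]addr0.
  by move/addrI => v00; rewrite v00 eqxx in v0.
apply/(jacobsonP mA mB); split=> // b bB.
have bxB : b ** x \in B by rewrite subalgebraM.
have [|[c cB []]] := idempotent_or_nilpotent mA mB bxB.
  exact: nilpotent_left_quasi_regular.
rewrite mA => e0 ee; have := rtrace_idempotent mA charF0 ee e0.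
by rewrite x0 ?eqxx // subalgebraM.
Qed.

Lemma jacobson_sub B : subalgebra m B -> (jacobson m B <= B)%VS.
Proof. by move=> mB; apply/subvP => x /jacobson_traceP[]. Qed.

Lemma jacobson_nilpotent B x : subalgebra m B -> x \in jacobson m B -> nilpotent m x.
Proof.
move=> mB /jacobson_traceP[] // xB x0.
have [//|[c cB [e0 ee]]] := idempotent_or_nilpotent mA mB xB.
by have := rtrace_idempotent mA charF0 ee e0; rewrite x0 ?eqxx.
Qed.

Lemma jacobson_ideal B : subalgebra m B -> ideal_of m B (jacobson m B).
Proof.
move=> mB; split; first exact: jacobson_sub.
  apply/mulv_subP => b x bB /(jacobson_traceP _ mB)[xB x0].
  apply/jacobson_traceP => //; split=> [|c cB]; first exact: subalgebraM.
  by rewrite mA x0 ?subalgebraM.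
apply/mulv_subP => x b /(jacobson_traceP _ mB)[xB x0] bB.
apply/jacobson_traceP => //; split=> [|c cB]; first exact: subalgebraM.
by rewrite mA rtraceC // mA x0 ?subalgebraM.
Qed.

Lemma jacobsonM B x y : subalgebra m B -> x \in B -> y \in jacobson m B ->
  x ** y \in jacobson m B /\ y ** x \in jacobson m B.
Proof.
by move=> mB xB yJ; have [_ ? ?] := ideal_ofM (jacobson_ideal mB) xB yJ.
Qed.

Lemma jacobson_idempotent B e :
  subalgebra m B -> e \in jacobson m B -> e ** e = e -> e = 0.
Proof.
move=> mB /(jacobson_nilpotent mB)[n <-] ee.
by elim: n => //= n <-; rewrite rmulvE.
Qed.

End Radical.

(** * Gradings *)

Section Grading.
Variables (F : fieldType) (A : vectType F) (m : {bilinear A -> A -> A}).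
Variables (gT : finGroupType) (gr : gT -> {vspace A}).
Hypothesis grA : is_grading m gr.
Local Notation "x ** y" := (m x y) (at level 40, left associativity).
Implicit Types (B I J S T U V W : {vspace A}) (x y z : A) (g h : gT).
Implicit Types (C D E : {set gT}) (H : {group gT}).

Definition hcomp g : 'End(A) := sumv_pi (\sum_(h : gT) gr h)%VS g.

Lemma hcomp_mem g x : hcomp g x \in gr g.
Proof. exact: memv_sum_pi. Qed.

Lemma hcomp_sum x : \sum_g hcomp g x = x.
Proof. by case: grA => _ fA _; apply: sumv_pi_sum; rewrite fA memvf. Qed.

Lemma hcomp_id g h x : x \in gr g -> hcomp h x = if h == g then x else 0.
Proof.
case: grA => dA _ _ xg.
pose u k := if k == g then x else 0.
have ugr k : true -> u k \in gr k.
  by rewrite /u; case: eqP => [->|_] _; rewrite ?mem0v.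
have cgr k : true -> hcomp k x \in gr k by move=> _; apply: hcomp_mem.
have := directv_sum_unique dA _ _ cgr ugr; rewrite hcomp_sum.
rewrite (bigD1 g) //= {1}/u eqxx big1 ?addr0 => [|k /negPf]; last by rewrite /u => ->.
by rewrite eqxx => /esym/forallP/(_ h)/eqP.
Qed.

Lemma hcomp_hcomp g h x : hcomp h (hcomp g x) = if h == g then hcomp g x else 0.
Proof. by rewrite (hcomp_id _ (hcomp_mem g x)). Qed.

Lemma hcomp_inj x : (forall g, hcomp g x = 0) -> x = 0.
Proof. by move=> x0; rewrite -(hcomp_sum x) big1. Qed.

Lemma hcomp_neq0 x : x != 0 -> exists g, hcomp g x != 0.
Proof.
move=> x0; apply: contrapT => nog; case/eqP: x0; apply: hcomp_inj => g.
by apply: contrapT => /eqP gx; apply: nog; exists g.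
Qed.

Lemma mul_gr g h x y : x \in gr g -> y \in gr h -> x ** y \in gr (g * h)%g.
Proof. by case: grA => _ _ gM xg yh; rewrite (subvP (gM g h)) ?mem_mulv. Qed.

Lemma hcompMl g h x y : x \in gr g -> hcomp h (x ** y) = x ** hcomp (g^-1 * h)%g y.
Proof.
move=> xg; rewrite -{1}(hcomp_sum y) linear_sumr linear_sum /=.
rewrite (bigD1 (g^-1 * h)%g) //= big1 ?addr0 => [|k k0].
  rewrite (hcomp_id _ (mul_gr xg (hcomp_mem _ _))).
  by rewrite mulgA mulgV mul1g eqxx.
rewrite (hcomp_id _ (mul_gr xg (hcomp_mem _ _))).
by case: eqP => // Dh; rewrite Dh mulKg eqxx in k0.
Qed.

Lemma hcompMr g h x y : y \in gr g -> hcomp h (x ** y) = hcomp (h * g^-1)%g x ** y.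
Proof.
move=> yg; rewrite -{1}(hcomp_sum x) linear_sumlz linear_sum /=.
rewrite (bigD1 (h * g^-1)%g) //= big1 ?addr0 => [|k k0].
  by rewrite (hcomp_id _ (mul_gr (hcomp_mem _ _) yg)) -mulgA mulVg mulg1 eqxx.
rewrite (hcomp_id _ (mul_gr (hcomp_mem _ _) yg)).
by case: eqP => // Dh; rewrite Dh mulgK eqxx in k0.
Qed.

(** For a subgroup C this is [graded_part]; cosets are needed as well. *)
Definition gpart C : {vspace A} := (\sum_(g in C) gr g)%VS.

Lemma gpartP C x : x \in gpart C <-> (forall g, g \notin C -> hcomp g x = 0).
Proof.
split=> [/memv_sumP[xs xsC ->] g gC | x0].
  rewrite linear_sum /= big1 // => h hC; rewrite (hcomp_id g (xsC h hC)).
  by case: eqP gC => // ->; rewrite hC.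
rewrite -(hcomp_sum x) (bigID (mem C)) /= [X in _ + X]big1 // addr0.
by rewrite memv_sumr // => g _; apply: hcomp_mem.
Qed.

Lemma gr_gpart g C x : g \in C -> x \in gr g -> x \in gpart C.
Proof.
move=> gC xg; apply/gpartP => h hC; rewrite (hcomp_id _ xg).
by case: eqP hC => // ->; rewrite gC.
Qed.

Lemma gpartM C D E x y : (forall g h, g \in C -> h \in D -> (g * h)%g \in E) ->
  x \in gpart C -> y \in gpart D -> x ** y \in gpart E.
Proof.
move=> CDE /memv_sumP[xs xsC ->] /memv_sumP[ys ysD ->].
rewrite linear_sumlz; apply: memv_suml => g gC.
rewrite linear_sumr; apply: memv_suml => h hD.
by apply: gr_gpart (CDE _ _ gC hD) _; rewrite mul_gr ?xsC ?ysD.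
Qed.

Lemma gpart_groupM H x y :
  x \in gpart H -> y \in gpart H -> x ** y \in gpart H.
Proof. by apply: gpartM => g h; apply: groupM. Qed.

Definition homogeneous U := forall x g, x \in U -> hcomp g x \in U.

Lemma gradedP H U : graded gr H U <-> homogeneous U /\ (U <= gpart H)%VS.
Proof.
split=> [gU | [hU sU]].
  have gUE x : x \in U -> exists2 xs : gT -> A,
      (forall g, g \in H -> xs g \in (U :&: gr g)%VS) & x = \sum_(g in H) xs g.
    by rewrite {1}gU => /memv_sumP.
  split=> [x g /gUE[xs xsH ->]|]; last first.
    apply/subvP => x /gUE[xs xsH ->]; apply: memv_sumr => g /xsH.
    by case/memv_capP.
  rewrite linear_sum /= memv_suml // => h /xsH /memv_capP[xU xh].
  by rewrite (hcomp_id _ xh); case: eqP; rewrite ?mem0v.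
apply/eqP; rewrite eqEsubv; apply/andP; split; last first.
  by apply/subv_sumP => g _; apply: capvSl.
apply/subvP => x xU; have /gpartP x0 := subvP sU x xU.
rewrite -(hcomp_sum x) (bigID (mem H)) /= [X in _ + X]big1 // addr0.
by rewrite memv_sumr // => g _; rewrite memv_cap hU ?hcomp_mem.
Qed.

Lemma gpart_setT : gpart [set: gT]%G = fullv.
Proof.
apply/eqP; rewrite eqEsubv subvf; apply/subvP => x _; apply/gpartP => g.
by rewrite inE.
Qed.

Lemma gradedTP U : graded gr [set: gT]%G U <-> homogeneous U.
Proof. by rewrite gradedP gpart_setT subvf; split=> [[]|]. Qed.

Lemma homogeneous0 : homogeneous 0.
Proof. by move=> x g; rewrite !memv0 => /eqP ->; rewrite linear0. Qed.

Lemma homogeneousf : homogeneous fullv.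
Proof. by move=> x g _; apply: memvf. Qed.

Lemma homogeneous_gpart C : homogeneous (gpart C).
Proof.
move=> x g /gpartP x0; apply/gpartP => h hC; rewrite hcomp_hcomp.
by case: eqP hC => // -> /x0.
Qed.

Lemma homogeneous_cap U V : homogeneous U -> homogeneous V -> homogeneous (U :&: V).
Proof. by move=> hU hV x g /memv_capP[xU xV]; rewrite memv_cap hU ?hV. Qed.

Lemma homogeneous_add U V : homogeneous U -> homogeneous V -> homogeneous (U + V).
Proof.
move=> hU hV _ g /memv_addP[x xU [y yV ->]].
by rewrite linearD memv_add ?hU ?hV.
Qed.

Lemma homogeneous_mul U V :
  homogeneous U -> homogeneous V -> homogeneous (mulv m U V).
Proof.
move=> hU hV x g xUV.
have : (mulv m U V <= hcomp g @^-1: mulv m U V)%VS; last first.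
  by move/subvP/(_ x xUV); rewrite -memv_preim.
apply/mulv_subP => u v uU vV; rewrite -memv_preim -(hcomp_sum u).
rewrite linear_sumlz linear_sum /=; apply: memv_suml => h _.
by rewrite (hcompMl _ _ (hcomp_mem h u)) mem_mulv ?hU ?hV.
Qed.

(** Multiplication by x sends the piece of degree h to the piece of degree g h,
    so all diagonal blocks of its matrix vanish. *)
Lemma rtrace_gr g x : g != 1%g -> x \in gr g -> rtrace m x = 0.
Proof.
move=> g1 xg; have L1 : lmulv m x = \sum_h (lmulv m x \o hcomp h)%VF.
  apply/lfunP => y; rewrite sum_lfunE lmulvE -{1}(hcomp_sum y) linear_sumr.
  by apply: eq_bigr => h _; rewrite comp_lfunE lmulvE.
rewrite /rtrace L1 linear_sum /= big1 // => h _.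
have -> : (lmulv m x \o hcomp h = (lmulv m x \o hcomp h) \o hcomp h)%VF.
  by apply/lfunP => y; rewrite !comp_lfunE hcomp_hcomp eqxx.
rewrite lftraceC; have -> : (hcomp h \o (lmulv m x \o hcomp h))%VF = 0.
  apply/lfunP => y; rewrite !comp_lfunE lmulvE (hcompMl _ _ xg) hcomp_hcomp.
  rewrite zero_lfunE; case: eqP => [|_]; last by rewrite linear0r.
  move/(canRL (mulgK _)); rewrite mulgV => /eqP; rewrite eq_invg1.
  by rewrite (negPf g1).
by rewrite linear0.
Qed.

Lemma rtrace_hcomp1 x : rtrace m x = rtrace m (hcomp 1%g x).
Proof.
rewrite -{1}(hcomp_sum x) linear_sum /= (bigD1 1%g) //= big1 ?addr0 // => g g1.
exact: rtrace_gr g1 (hcomp_mem g x).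
Qed.

(** Pieces of degrees g and h are orthogonal unless g h = 1, so the orthogonal of
    a graded subspace is graded. *)
Lemma rtrace_orthogonal_hcomp T x g : homogeneous T ->
  (forall t, t \in T -> rtrace m (t ** x) = 0) ->
  forall t, t \in T -> rtrace m (t ** hcomp g x) = 0.
Proof.
move=> hT x0 t tT; rewrite rtrace_hcomp1 (hcompMr _ _ (hcomp_mem g x)) mul1g.
have <- : hcomp 1%g (hcomp g^-1%g t ** x) = hcomp g^-1%g t ** hcomp g x.
  by rewrite (hcompMl _ _ (hcomp_mem _ _)) mulg1 invgK.
by rewrite -rtrace_hcomp1 x0 ?hT.
Qed.

End Grading.

Section GradedRadical.
Variables (F : closedFieldType) (A : vectType F) (m : {bilinear A -> A -> A}).
Variables (gT : finGroupType) (gr : gT -> {vspace A}).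
Hypothesis charF0 : [pchar F] =i pred0.
Hypothesis mA : associative m.
Hypothesis grA : is_grading m gr.
Implicit Types (B I J S T U V W : {vspace A}) (x y z : A) (g h : gT).
Implicit Types (K : {group gT}).

Lemma homogeneous_jacobson B :
  subalgebra m B -> homogeneous gr B -> homogeneous gr (jacobson m B).
Proof.
move=> mB hB x g /(jacobson_traceP charF0 mA _ mB)[xB x0].
apply/jacobson_traceP => //; split; first exact: hB.
exact: rtrace_orthogonal_hcomp.
Qed.

Lemma subalgebra_gpart K B : subalgebra m B -> subalgebra m (B :&: gpart gr K)%VS.
Proof.
move=> mB; apply/mulv_subP => u v /memv_capP[uB uK] /memv_capP[vB vK].
by rewrite memv_cap subalgebraM // (gpart_groupM grA).
Qed.

(** An x of degrees in K is orthogonal to all pieces of degree outside K, so the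
    conditions for B and for its K-part coincide. *)
Lemma jacobson_gpart K B : subalgebra m B -> homogeneous gr B ->
  jacobson m (B :&: gpart gr K)%VS = (jacobson m B :&: gpart gr K)%VS.
Proof.
move=> mB hB; have mBK := subalgebra_gpart K mB.
apply/vspaceP => x; apply/idP/memv_capP.
  case/(jacobson_traceP charF0 mA _ mBK) => /memv_capP[xB xK] x0; split=> //.
  apply/jacobson_traceP => //; split=> // b bB.
  rewrite -(hcomp_sum grA b) linear_sumlz linear_sum /= big1 // => g _.
  have [gK|gK] := boolP (g \in K).
    by rewrite x0 // memv_cap hB //= (gr_gpart grA gK) ?hcomp_mem.
  rewrite (rtrace_hcomp1 grA) (hcompMl grA _ _ (hcomp_mem gr g b)) mulg1.
  move/(gpartP grA): xK => ->; first by rewrite linear0r linear0.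
  by rewrite groupV.
case=> /(jacobson_traceP charF0 mA _ mB)[xB x0] xK.
apply/jacobson_traceP => //; split; first by rewrite memv_cap xB.
by move=> b /memv_capP[bB _]; apply: x0.
Qed.

End GradedRadical.

(** * Graded semisimple algebras are sums of graded simple ideals *)

Section Subspaces.
Variables (F : fieldType) (A : vectType F).
Implicit Types (S T U V : {vspace A}).

Lemma minimal_vspace (P : {vspace A} -> Prop) U : P U ->
  exists2 T, P T & forall T', P T' -> (T' <= T)%VS -> T' = T.
Proof.
have [n] := ubnP (\dim U); elim: n U => // n IHn U dU PU.
have [[T [PT TU dTU]]|noT] :=
  pselect (exists T, [/\ P T, (T <= U)%VS & (\dim T < \dim U)%N]).
  by apply: (IHn T) => //; apply: leq_trans dTU _; rewrite -ltnS.
exists U => // T PT TU; apply/eqP; rewrite eqEdim TU leqNgt; apply/negP => dTU.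
by apply: noT; exists T.
Qed.

(** The pairing is given by the linear maps bl t and br x that fix one of the
    arguments: both its left and its right version serve later. *)
Lemma dim_orthogonal (bl br : A -> 'Hom(A, F^o)) T U :
    (forall t x, bl t x = br x t) ->
  exists2 U' : {vspace A}, forall x, x \in U' <-> x \in U /\ (forall t, t \in T -> bl t x = 0)
            & (\dim U <= \dim T + \dim U')%N.
Proof.
move=> blr.
have dK (fs : seq 'Hom(A, F^o)) :
    (\dim U <= size fs + \dim (U :&: \bigcap_(f <- fs) lker f))%N.
  elim: fs => [|f fs IHfs]; first by rewrite big_nil capvf.
  apply: leq_trans IHfs _; rewrite big_cons /= addSnnS leq_add2l.
  set C := (\bigcap_(_ <- fs) _)%VS.
  rewrite (capvC (lker f)) capvA -(limg_ker_dim f (U :&: C)%VS) -addn1 leq_add2l.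
  by apply: leq_trans (dimvS (subvf _)) _; rewrite dimvf.
have capE (fs : seq 'Hom(A, F^o)) x :
    (x \in \bigcap_(f <- fs) lker f)%VS = all (fun f : 'Hom(A, F^o) => f x == 0) fs.
  elim: fs => [|f fs IHfs]; first by rewrite big_nil memvf.
  by rewrite big_cons memv_cap memv_ker IHfs.
exists (U :&: \bigcap_(f <- [seq bl t | t <- vbasis T]) lker f)%VS.
  move=> x; rewrite memv_cap capE all_map; split=> [/andP[xU /allP x0] | [xU x0]].
    split=> // t tT; rewrite blr; apply/eqP; rewrite -memv_ker.
    apply: (subvP _ t tT); rewrite -{1}(span_basis (vbasisP T)).
    by apply/span_subvP => u uT; rewrite memv_ker -blr; apply: x0.
  by rewrite xU; apply/allP => u uT; rewrite /= x0 // (vbasis_mem uT).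
by have := dK [seq bl t | t <- vbasis T]; rewrite size_map size_tuple.
Qed.

Lemma nondegenerate_dim (bl br : A -> 'Hom(A, F^o)) T U :
    (forall t x, bl t x = br x t) ->
    (forall x, x \in U -> (forall t, t \in T -> bl t x = 0) -> x = 0) ->
  (\dim U <= \dim T)%N.
Proof.
move=> blr nd; have [U' U'P dU] := dim_orthogonal T U blr.
suff U'0 : U' = 0%VS by rewrite U'0 dimv0 addn0 in dU.
by apply/eqP; rewrite -subv0; apply/subvP => x /U'P[xU x0]; rewrite memv0 (nd x).
Qed.

End Subspaces.

Section Decomposition.
Variables (F : closedFieldType) (A : vectType F) (m : {bilinear A -> A -> A}).
Variables (gT : finGroupType) (gr : gT -> {vspace A}).
Hypothesis charF0 : [pchar F] =i pred0.
Hypothesis mA : associative m.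
Hypothesis grA : is_grading m gr.
Local Notation "x ** y" := (m x y) (at level 40, left associativity).
Implicit Types (B I J T U V W : {vspace A}) (x y z : A) (g h : gT).

Variables (K : {group gT}) (S : {vspace A}).
Hypothesis mS : subalgebra m S.
Hypothesis gS : graded gr K S.
Hypothesis ssS : semisimple m S.

Lemma nilpotent_ideal0 I : ideal_of m S I ->
  (forall x, x \in I -> nilpotent m x) -> I = 0%VS.
Proof.
move=> iI nI; apply/eqP; rewrite -subv0 -ssS; apply/subvP => x xI.
apply/jacobsonP => //; split=> [|b bS].
  by have [sI _ _] := iI; rewrite (subvP sI).
have [xS bxI _] := ideal_ofM iI bS xI.
apply: nilpotent_left_quasi_regular => //; last exact: nI.
exact: subalgebraM.
Qed.

(** The intersection of T with its orthogonal is a nil ideal: a nonzero idempotent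
    multiple e = c x = (e c) x would have trace 0, as e c lies in T. *)
Lemma orthogonal_ideal T U :
    ideal_of m S T -> ideal_of m S U -> homogeneous gr T -> homogeneous gr U ->
    (T <= U)%VS ->
  exists U', [/\ ideal_of m S U', homogeneous gr U', (T :&: U' = 0)%VS &
                 (T + U')%VS = U].
Proof.
move=> iT iU hT hU TU.
pose tau : 'Hom(A, F^o) := linfun (rtrace m : A -> F^o).
have [U' U'P dU] := @dim_orthogonal _ _ (fun t => tau \o lmulv m t)%VF
  (fun x => tau \o rmulv m x)%VF T U
  (fun t x => ltac:(by rewrite !comp_lfunE lmulvE rmulvE)).
have tauE t x : (tau \o lmulv m t)%VF x = rtrace m (t ** x).
  by rewrite comp_lfunE lmulvE lfunE.
have U'P2 x : x \in U' <-> x \in U /\ (forall t, t \in T -> rtrace m (t ** x) = 0).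
  by rewrite U'P; split=> -[xU x0]; split=> // t /x0; rewrite tauE.
have iU' : ideal_of m S U'.
  split.
  - by apply/subvP => x /U'P2[xU _]; have [sU _ _] := iU; apply: (subvP sU).
  - apply/mulv_subP => b x bS /U'P2[xU x0].
    have [xS bxU _] := ideal_ofM iU bS xU.
    apply/U'P2; split=> // t tT; rewrite mA x0 //.
    by have [] := ideal_ofM iT bS tT.
  apply/mulv_subP => x b /U'P2[xU x0] bS.
  have [xS _ xbU] := ideal_ofM iU bS xU.
  apply/U'P2; split=> // t tT; rewrite mA rtraceC // mA x0 //.
  by have [] := ideal_ofM iT bS tT.
have hU' : homogeneous gr U'.
  move=> x g /U'P2[xU x0]; apply/U'P2; split; first exact: hU.
  exact: rtrace_orthogonal_hcomp.
have TU'0 : (T :&: U' = 0)%VS.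
  apply: nilpotent_ideal0.
    have [[sT lT rT] [sU' lU' rU']] := (iT, iU').
    split; first exact: subv_trans (capvSl _ _) sT.
      apply/mulv_subP => b x bS /memv_capP[xT xU'].
      by rewrite memv_cap (subvP lT) ?(subvP lU') ?mem_mulv.
    apply/mulv_subP => x b /memv_capP[xT xU'] bS.
    by rewrite memv_cap (subvP rT) ?(subvP rU') ?mem_mulv.
  move=> x /memv_capP[xT xU'].
  have xS : x \in S by have [sT _ _] := iT; apply: (subvP sT).
  have [//|[c cS [e0 ee]]] := idempotent_or_nilpotent mA mS xS.
  have := rtrace_idempotent mA charF0 ee e0; rewrite -ee mA.
  move/U'P2: xU' => [_ ->]; first by rewrite eqxx.
  have [_ cxT _] := ideal_ofM iT cS xT.
  by have [_ _] := ideal_ofM iT cS cxT.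
exists U'; split=> //; apply/eqP; rewrite eqEdim subv_add TU /=.
rewrite dimv_disjoint_sum // dU andbT.
by apply/subvP => x /U'P2[].
Qed.

(** The orthogonal complement of T annihilates T, so the ideals of the algebra T
    are ideals of S. *)
Lemma minimal_ideal_simple T :
    ideal_of m S T -> homogeneous gr T -> T <> 0%VS ->
    (forall I, ideal_of m S I -> homogeneous gr I -> (I <= T)%VS ->
       I = 0%VS \/ I = T) ->
  graded_simple m gr K T.
Proof.
move=> iT hT T0 minT; have [sT lT rT] := iT.
have sSK : (S <= gpart gr K)%VS by have /(gradedP grA)[] := gS.
split.
- by apply/mulv_subP => u v uT vT; rewrite (subvP lT) ?mem_mulv ?(subvP sT).
- by apply/(gradedP grA); split=> //; apply: subv_trans sT sSK.
- move=> TT0; apply: T0; apply: nilpotent_ideal0 => // x xT; exists 1%N.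
  by rewrite /= rmulvE; apply/eqP; rewrite -memv0 -TT0 mem_mulv.
move=> I [IT lI rI] /(gradedP grA)[hI _]; apply: minT => //.
have iS : ideal_of m S S by split.
have hS : homogeneous gr S by have /(gradedP grA)[] := gS.
have [S' [[sS' lS' rS'] _ TS' DS]] := orthogonal_ideal iT iS hT hS sT.
have ann x s : x \in T -> s \in S' -> x ** s = 0 /\ s ** x = 0.
  move=> xT sS; have xS := subvP sT x xT; have sS1 := subvP sS' s sS.
  have [_ sx xs] := ideal_ofM iT sS1 xT.
  split; apply/eqP; rewrite -memv0 -TS' memv_cap ?xs ?sx /=.
    by rewrite (subvP lS') ?mem_mulv.
  by rewrite (subvP rS') ?mem_mulv.
split; first exact: subv_trans IT sT.
  apply/mulv_subP => b x; rewrite -{1}DS => /memv_addP[t tT [s sS ->]] xI.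
  rewrite linearDl /= (ann x s _ sS).2 ?(subvP IT) // addr0.
  by rewrite (subvP lI) ?mem_mulv.
apply/mulv_subP => x b xI; rewrite -{1}DS => /memv_addP[t tT [s sS ->]].
rewrite linearDr /= (ann x s _ sS).1 ?(subvP IT) // addr0.
by rewrite (subvP rI) ?mem_mulv.
Qed.

Lemma graded_ideal_decomposition U :
    ideal_of m S U -> homogeneous gr U ->
  exists Ts : seq {vspace A},
    [/\ (\sum_(i < size Ts) component Ts i)%VS = U,
        directv (\sum_(i < size Ts) component Ts i)%VS
      & forall i : 'I_(size Ts),
          ideal_of m S (component Ts i) /\ graded_simple m gr K (component Ts i)].
Proof.
have [n] := ubnP (\dim U); elim: n U => // n IHn U dU iU hU.
have [U0|/eqP U0] := eqVneq U 0%VS.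
  exists [::]; split=> [||[]//]; first by rewrite big_ord0.
  by rewrite directvE /= !big_ord0 dimv0.
have [T [iT hT TU T0] minT] := @minimal_vspace _ A (fun T =>
  [/\ ideal_of m S T, homogeneous gr T, (T <= U)%VS & T <> 0%VS]) U
  (And4 iU hU (subvv U) U0).
have sT : graded_simple m gr K T.
  apply: minimal_ideal_simple => // I iI hI IT.
  have [I0|/eqP I0] := eqVneq I 0%VS; [by left | right; apply: minT => //].
  by split=> //; apply: subv_trans TU.
have [U' [iU' hU' TU'0 DU]] := orthogonal_ideal iT iU hT hU TU.
have dU' : (\dim U' < n)%N.
  rewrite -ltnS; apply: leq_trans dU; rewrite ltnS -DU dimv_disjoint_sum // -addn1 addnC leq_add2r.
  by rewrite lt0n dimv_eq0; apply/eqP.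
have [Ts [sTs dTs Ts_simple]] := IHn U' dU' iU' hU'.
exists (T :: Ts); split=> [||i].
- by rewrite /= big_ord_recl /= -DU -sTs.
- rewrite directvE /= !big_ord_recl /=.
  have sTs' : (\sum_(i < size Ts) nth 0%VS (T :: Ts) (lift ord0 i))%VS = U' by [].
  have := TU'0; rewrite -{1}sTs' => /dimv_disjoint_sum ->; rewrite eqn_add2l.
  by move: dTs; rewrite directvE.
by case: (unliftP ord0 i) => [j|] -> //; exact: Ts_simple.
Qed.

End Decomposition.

(** * A primitive idempotent of a graded simple algebra *)

Section GradedSimple.
Variables (F : fieldType) (A : vectType F) (m : {bilinear A -> A -> A}).
Variables (gT : finGroupType) (gr : gT -> {vspace A}).
Hypothesis mA : associative m.
Hypothesis grA : is_grading m gr.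
Local Notation "x ** y" := (m x y) (at level 40, left associativity).
Local Notation hcomp := (hcomp gr).
Local Notation homogeneous := (homogeneous gr).
Local Notation gpart := (gpart gr).
Implicit Types (I T U V W : {vspace A}) (x y z : A) (g h : gT) (C : {set gT}).

Variable R : {vspace A}.
Hypothesis sR : graded_simple m gr [set: gT]%G R.

Let mR : subalgebra m R. Proof. by case: sR. Qed.
Let hR : homogeneous R. Proof. by case: sR => _ /(gradedTP grA). Qed.
Let RM x y : x \in R -> y \in R -> x ** y \in R. Proof. exact: subalgebraM. Qed.
Let simpleR I : ideal_of m R I -> homogeneous I -> I = 0%VS \/ I = R.
Proof. by move=> iI hI; case: sR => _ _ _; apply=> //; apply/(gradedTP grA). Qed.
Let RR_neq0 : ~ (forall x y, x \in R -> y \in R -> x ** y = 0).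
Proof.
case: sR => _ _ RR0 _ R0; apply: RR0; apply/eqP; rewrite -subv0.
by apply/mulv_subP => x y xR yR; rewrite memv0 R0.
Qed.

Lemma homogeneous_limg_lmulv g x U :
  x \in gr g -> homogeneous U -> homogeneous (lmulv m x @: U).
Proof.
move=> xg hU _ h /memv_imgP[u uU ->]; rewrite lmulvE (hcompMl grA _ _ xg) -lmulvE.
by rewrite memv_img ?hU.
Qed.

Lemma homogeneous_lker_lmulv g x : x \in gr g -> homogeneous (lker (lmulv m x)).
Proof.
move=> xg u h; rewrite !memv_ker !lmulvE => /eqP xu0.
have := hcompMl grA (g * h)%g u xg; rewrite xu0 linear0 mulKg => <-; exact: eqxx.
Qed.

Lemma homogeneous_limg_rmulv g x U :
  x \in gr g -> homogeneous U -> homogeneous (rmulv m x @: U).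
Proof.
move=> xg hU _ h /memv_imgP[u uU ->]; rewrite rmulvE (hcompMr grA _ _ xg) -rmulvE.
by rewrite memv_img ?hU.
Qed.

(** The last clause says that every nonzero homogeneous element of f R generates
    f R as a right ideal. *)
Definition graded_primitive f :=
  [/\ f \in R, f \in gr 1%g, f ** f = f, f != 0 &
      forall g v, v \in R -> v \in gr g -> f ** v = v -> v != 0 ->
        exists2 r, r \in R /\ r \in gr g^-1%g & v ** r = f].

Let right_ideal V := (mulv m V R <= V)%VS.

(** Brauer's lemma for graded ideals: a minimal graded right ideal V is not of
    square zero, so v V = V for some homogeneous v in V; the solution f in V of
    v f = v of degree 1 is idempotent, because left multiplication by v is
    injective on V. *)
Lemma exists_graded_primitive : exists f, graded_primitive f.
Proof.
have R0 : R <> 0%VS.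
  move=> R0; apply: RR_neq0 => x y; rewrite R0 memv0 => /eqP -> _.
  exact: linear0l.
have [V [VR hV rV V0] minV] := @minimal_vspace _ A (fun V =>
  [/\ (V <= R)%VS, homogeneous V, right_ideal V & V <> 0%VS]) R
  (And4 (subvv R) hR mR R0).
have rVM x y : x \in V -> y \in R -> x ** y \in V.
  by move=> xV yR; rewrite (subvP rV) ?mem_mulv.
have VV_neq0 : ~ (forall x y, x \in V -> y \in V -> x ** y = 0).
  (* If V V = 0, then the two-sided ideal V + R V is all of R and has square 0. *)
  move=> VV0; pose I := (V + mulv m R V)%VS.
  have VRV x y : x \in V -> y \in mulv m R V -> x ** y = 0.
    move=> xV; suff /subvP sub : (mulv m R V <= lker (lmulv m x))%VS.
      by move/sub; rewrite memv_ker lmulvE => /eqP.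
    apply/mulv_subP => r v rR vV.
    by rewrite memv_ker lmulvE mA VV0 ?rVM.
  have VI x y : x \in V -> y \in I -> x ** y = 0.
    by move=> xV /memv_addP[v vV [w wRV ->]]; rewrite linearDr /= VV0 // VRV // addr0.
  have II x y : x \in I -> y \in I -> x ** y = 0.
    case/memv_addP=> v vV [w wRV ->] yI; rewrite linearDl /= VI // add0r.
    apply/eqP; rewrite -rmulvE -memv_ker; apply: (subvP _ _ wRV).
    apply/mulv_subP => r u rR uV.
    by rewrite memv_ker rmulvE -mA (VI u) // linear0r.
  have iI : ideal_of m R I.
    split.
    - rewrite subv_add VR; apply/mulv_subP => r v rR vV.
      by rewrite RM // (subvP VR).
    - apply/mulv_subP => r x rR /memv_addP[v vV [w wRV ->]].
      rewrite linearDr /= memvD // (subvP (addvSr _ _)) //.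
        exact: mem_mulv.
      rewrite -lmulvE memv_preim; apply: (subvP _ _ wRV).
      apply/mulv_subP => r1 v1 r1R v1V.
      by rewrite -memv_preim lmulvE mA mem_mulv ?RM.
    apply/mulv_subP => x r /memv_addP[v vV [w wRV ->]] rR.
    rewrite linearDl /= memvD //.
      by rewrite (subvP (addvSl _ _)) ?rVM.
    rewrite (subvP (addvSr _ _)) // -rmulvE memv_preim; apply: (subvP _ _ wRV).
    apply/mulv_subP => r1 v1 r1R v1V.
    by rewrite -memv_preim rmulvE -mA mem_mulv ?rVM.
  have hI : homogeneous I.
    by apply: homogeneous_add => //; apply: homogeneous_mul.
  have [I0|IR] := simpleR iI hI.
    by apply: V0; apply/eqP; rewrite -subv0 -I0 addvSl.
  by apply: RR_neq0; rewrite -IR.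
have [g [v [vV vg [w wV vw0]]]] :
    exists g v, [/\ v \in V, v \in gr g & exists2 w, w \in V & v ** w != 0].
  apply: contrapT => no; apply: VV_neq0 => x y xV yV.
  rewrite -(hcomp_sum grA x) linear_sumlz big1 // => g _.
  apply: contrapT => /eqP xy0; apply: no; exists g, (hcomp g x).
  by split; rewrite ?hcomp_mem ?hV //; exists y.
have VE U : (U <= V)%VS -> homogeneous U -> right_ideal U -> U <> 0%VS -> U = V.
  by move=> UV hU rU U0; apply: minV => //; split=> //; apply: subv_trans UV VR.
have rlmul x U : right_ideal U -> right_ideal (lmulv m x @: U)%VS.
  move=> rU; apply/mulv_subP => _ r /memv_imgP[u uU ->] rR.
  by rewrite lmulvE -mA -lmulvE memv_img // (subvP rU) ?mem_mulv.
have vVE : (lmulv m v @: V)%VS = V.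
  apply: (VE); last 1 first.
  - by move=> vV0; case/eqP: vw0; apply/eqP; rewrite -memv0 -vV0 -lmulvE memv_img.
  - apply/subvP => _ /memv_imgP[u uV ->]; rewrite lmulvE rVM //.
    exact: (subvP VR).
  - exact: homogeneous_limg_lmulv vg hV.
  exact: rlmul.
have v_inj u : u \in V -> v ** u = 0 -> u = 0.
  move=> uV vu0; apply: contrapT => /eqP u0.
  suff VK : (V :&: lker (lmulv m v) = V)%VS.
    move: wV; rewrite -VK memv_cap memv_ker lmulvE => /andP[_].
    by rewrite (negPf vw0).
  apply: (VE); first exact: capvSl.
  - by apply: homogeneous_cap => //; apply: homogeneous_lker_lmulv vg.
  - apply/mulv_subP => x r /memv_capP[xV]; rewrite memv_ker lmulvE => /eqP vx0 rR.
    by rewrite memv_cap rVM //= memv_ker lmulvE mA vx0 linear0l.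
  move=> VK0; case/eqP: u0; apply/eqP.
  by rewrite -memv0 -VK0 memv_cap uV memv_ker lmulvE vu0 eqxx.
have : v \in (lmulv m v @: V)%VS by rewrite vVE.
case/memv_imgP => f0 f0V; rewrite lmulvE => Dv.
pose f := hcomp 1%g f0.
have fV : f \in V by apply: hV.
have vf : v ** f = v.
  have := hcompMl grA g f0 vg; rewrite -Dv mulVg -/f => <-.
  by rewrite (hcomp_id grA _ vg) eqxx.
have v0 : v != 0 by apply: contra_neq vw0 => ->; rewrite linear0l.
have f_neq0 : f != 0 by apply: contra_neq v0 => f00; rewrite -vf f00 linear0r.
have fR : f \in R by rewrite (subvP VR).
have ff : f ** f = f.
  apply/eqP; rewrite -subr_eq0; apply/eqP/v_inj; first by rewrite memvB ?rVM.
  by rewrite linearBr /= mA !vf subrr.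
exists f; split=> //; first exact: hcomp_mem.
move=> h x xR xh fx x0.
have xV : x \in V by rewrite -fx rVM.
have xRE : (lmulv m x @: R)%VS = V.
  apply: (VE).
  - by apply/subvP => _ /memv_imgP[u uR ->]; rewrite lmulvE rVM.
  - exact: homogeneous_limg_lmulv xh hR.
  - exact: rlmul.
  move=> xR0.
  have [N NP] : exists N : {vspace A}, forall y,
      y \in N <-> y \in V /\ forall r, r \in R -> y ** r = 0.
    apply: linear_pred_vspace => [|a y z [yV y0] [zV z0]].
      by rewrite mem0v; split=> // r _; rewrite linear0l.
    split=> [|r rR]; first by rewrite memvD ?memvZ.
    by rewrite linearDl linearZl_LR /= y0 ?z0 // scaler0 addr0.
  have NV : N = V.
    apply: (VE).
    - by apply/subvP => y /NP[].
    - move=> y k /NP[yV y0]; apply/NP; split=> [|r rR]; first exact: hV.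
      rewrite -(hcomp_sum grA r) linear_sumr big1 // => l _.
      have := hcompMr grA (k * l)%g y (hcomp_mem gr l r); rewrite mulgK => <-.
      by rewrite y0 ?hR // linear0.
    - apply/mulv_subP => y r /NP[yV y0] rR; apply/NP; split=> [|r1 r1R].
        by rewrite rVM.
      by rewrite y0 // linear0l.
    move=> N0; case/eqP: x0; apply/eqP; rewrite -memv0 -N0; apply/NP; split=> // r rR.
    by apply/eqP; rewrite -memv0 -xR0 -lmulvE memv_img.
  apply: VV_neq0 => y z; rewrite -{1}NV => /NP[_ y0] zV.
  by apply: y0; apply: (subvP VR).
have : f \in (lmulv m x @: R)%VS by rewrite xRE.
case/memv_imgP => r rR; rewrite lmulvE => Df.
exists (hcomp h^-1%g r); first by rewrite hR ?hcomp_mem.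
have := hcompMl grA 1%g r xh; rewrite -Df mulg1 => <-.
by rewrite (hcomp_id grA _ (hcomp_mem gr _ _)) eqxx.
Qed.

End GradedSimple.

(** * The dimensions of the modules and of the graded division algebra *)

Lemma exists_functional (F : fieldType) (A : vectType F) (x : A) :
  x != 0 -> exists psi : 'Hom(A, F^o), psi x != 0.
Proof.
move=> x0; apply: contrapT => no; case/eqP: x0.
rewrite (coord_vbasis (memvf x)) big1 // => i _.
suff -> : coord (vbasis fullv) i x = 0 by rewrite scale0r.
apply: contrapT => /eqP xi; apply: no.
by exists (linfun (coord (vbasis fullv) i : A -> F^o)); rewrite lfunE.
Qed.

Section Primitive.
Variables (F : fieldType) (A : vectType F) (m : {bilinear A -> A -> A}).
Variables (gT : finGroupType) (gr : gT -> {vspace A}).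
Hypothesis mA : associative m.
Hypothesis grA : is_grading m gr.
Local Notation "x ** y" := (m x y) (at level 40, left associativity).
Local Notation hcomp := (hcomp gr).
Local Notation homogeneous := (homogeneous gr).
Local Notation gpart := (gpart gr).
Implicit Types (I T U V W : {vspace A}) (x y z : A) (g h : gT) (C : {set gT}).

Variable R : {vspace A}.
Hypothesis sR : graded_simple m gr [set: gT]%G R.
Variable f : A.
Hypothesis fP : graded_primitive m gr R f.

Let mR : subalgebra m R. Proof. by case: sR. Qed.
Let hR : homogeneous R. Proof. by case: sR => _ /(gradedTP grA). Qed.
Let RM x y : x \in R -> y \in R -> x ** y \in R. Proof. exact: subalgebraM. Qed.
Let simpleR I : ideal_of m R I -> homogeneous I -> I = 0%VS \/ I = R.
Proof. by move=> iI hI; case: sR => _ _ _; apply=> //; apply/(gradedTP grA). Qed.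
Let RR_neq0 : ~ (forall x y, x \in R -> y \in R -> x ** y = 0).
Proof.
case: sR => _ _ RR0 _ R0; apply: RR0; apply/eqP; rewrite -subv0.
by apply/mulv_subP => x y xR yR; rewrite memv0 R0.
Qed.
Let fR : f \in R. Proof. by case: fP. Qed.
Let f1 : f \in gr 1%g. Proof. by case: fP. Qed.
Let ff : f ** f = f. Proof. by case: fP. Qed.
Let f_neq0 : f != 0. Proof. by case: fP. Qed.

Lemma simple_gen_primitive : mulv m (mulv m R <[f]>) R = R.
Proof.
set I := mulv m _ R.
have RfR x : x \in mulv m R <[f]>%VS -> x \in R.
  apply: subvP; apply/mulv_subP => r _ rR /vlineP[a ->].
  by rewrite RM ?memvZ.
have fI : f \in I.
  have : f ** f ** f \in I.
    by apply: mem_mulv => //; apply: mem_mulv => //; apply: memv_line.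
  by rewrite !ff.
have hf : homogeneous <[f]>%VS.
  move=> x g /vlineP[a ->]; rewrite linearZ /= memvZ // (hcomp_id grA _ f1).
  by case: eqP; rewrite ?memv_line ?mem0v.
have [I0|//] : I = 0%VS \/ I = R.
  apply: simpleR; last by do 2?[apply: homogeneous_mul => //].
  split.
  - by apply/mulv_subP => x r xRf rR; rewrite RM ?(RfR x).
  - apply/mulv_subP => r x rR xI; rewrite -lmulvE memv_preim; apply: (subvP _ _ xI).
    apply/mulv_subP => y r1 yRf r1R; rewrite -memv_preim lmulvE mA mem_mulv //.
    rewrite -lmulvE memv_preim; apply: (subvP _ _ yRf).
    apply/mulv_subP => r2 z r2R zf; rewrite -memv_preim lmulvE mA mem_mulv //.
    exact: RM.
  apply/mulv_subP => x r xI rR; rewrite -rmulvE memv_preim; apply: (subvP _ _ xI).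
  apply/mulv_subP => y r1 yRf r1R; rewrite -memv_preim rmulvE -mA mem_mulv //.
  exact: RM.
by move: fI f_neq0; rewrite I0 memv0 => /eqP ->; rewrite eqxx.
Qed.

Lemma mulv_RfR_sub V :
  (forall r s, r \in R -> s \in R -> r ** f ** s \in V) -> (R <= V)%VS.
Proof.
move=> RfRV; rewrite -{1}simple_gen_primitive; apply/mulv_subP => x s xRf sinR.
rewrite -rmulvE memv_preim; apply: (subvP _ _ xRf).
apply/mulv_subP => r _ rR /vlineP[a ->].
by rewrite -memv_preim rmulvE linearZr linearZl_LR /= memvZ ?RfRV.
Qed.

(** From f R x = 0 follows R x = R f R x = 0, and the right annihilator of R is a
    graded ideal other than R. *)
Lemma primitive_faithful x : x \in R -> (forall r, r \in R -> f ** r ** x = 0) -> x = 0.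
Proof.
move=> xR fRx0.
have Rx0 r : r \in R -> r ** x = 0.
  move=> rR; apply/eqP; rewrite -rmulvE -memv_ker.
  apply: (subvP _ r rR); apply: mulv_RfR_sub => r1 r2 r1R r2R.
  by rewrite memv_ker rmulvE -!mA [f ** _]mA fRx0 // linear0r.
have [N NP] : exists N : {vspace A}, forall y,
    y \in N <-> y \in R /\ forall r, r \in R -> r ** y = 0.
  apply: linear_pred_vspace => [|a y z [yV y0] [zV z0]].
    by rewrite mem0v; split=> // r _; rewrite linear0r.
  split=> [|r rR]; first by rewrite memvD ?memvZ.
  by rewrite linearDr linearZr_LR /= y0 ?z0 // scaler0 addr0.
have [N0|NR] : N = 0%VS \/ N = R.
  apply: simpleR; first split.
  - by apply/subvP => y /NP[].
  - by apply/mulv_subP => r y rR /NP[yR y0]; rewrite y0 // mem0v.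
  - apply/mulv_subP => y r /NP[yR y0] rR; apply/NP; split=> [|s sinR]; first exact: RM.
    by rewrite mA y0 // linear0l.
  move=> y g /NP[yR y0]; apply/NP; split=> [|r rR]; first exact: hR.
  rewrite -(hcomp_sum grA r) linear_sumlz big1 // => l _.
  have := hcompMl grA (l * g)%g y (hcomp_mem gr l r); rewrite mulKg => <-.
  by rewrite y0 ?hR // linear0.
- by apply/eqP; rewrite -memv0 -N0; apply/NP.
by case: RR_neq0 => r y rR; rewrite -NR => /NP[_ ->].
Qed.

(** The minimal graded right ideal f R, the left ideal R f, and the graded division
    algebra f R f. *)
Definition rmod : {vspace A} := (lmulv m f @: R)%VS.
Definition lmod : {vspace A} := (rmulv m f @: R)%VS.
Definition corner : {vspace A} := (rmod :&: lmod)%VS.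

Lemma rmodP x : x \in rmod <-> x \in R /\ f ** x = x.
Proof.
split=> [/memv_imgP[r rR ->] | [xR <-]]; last by rewrite -lmulvE memv_img.
by rewrite lmulvE RM // mA ff.
Qed.

Lemma lmodP x : x \in lmod <-> x \in R /\ x ** f = x.
Proof.
split=> [/memv_imgP[r rR ->] | [xR <-]]; last by rewrite -rmulvE memv_img.
by rewrite rmulvE RM // -mA ff.
Qed.

Lemma mem_rmod r : r \in R -> f ** r \in rmod.
Proof. by move=> rR; rewrite -lmulvE memv_img. Qed.

Lemma mem_lmod r : r \in R -> r ** f \in lmod.
Proof. by move=> rR; rewrite -rmulvE memv_img. Qed.

Lemma rmodM x r : x \in rmod -> r \in R -> x ** r \in rmod.
Proof. by move=> /rmodP[xR fx] rR; apply/rmodP; rewrite mA fx RM. Qed.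

Lemma lmodM r x : r \in R -> x \in lmod -> r ** x \in lmod.
Proof. by move=> rR /lmodP[xR fx]; apply/lmodP; rewrite -mA fx RM. Qed.

Lemma cornerM x y : x \in rmod -> y \in lmod -> x ** y \in corner.
Proof.
move=> xf yf; have [[xR _] [yR _]] := ((rmodP x).1 xf, (lmodP y).1 yf).
by rewrite memv_cap rmodM ?lmodM.
Qed.

Lemma homogeneous_rmod : homogeneous rmod.
Proof. exact: homogeneous_limg_lmulv f1 hR. Qed.

Lemma homogeneous_lmod : homogeneous lmod.
Proof. exact: homogeneous_limg_rmulv f1 hR. Qed.

Lemma homogeneous_corner : homogeneous corner.
Proof. by apply: homogeneous_cap; [apply: homogeneous_rmod | apply: homogeneous_lmod]. Qed.

Lemma rmod_right_inverse g v : v \in rmod -> v \in gr g -> v != 0 ->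
  exists2 w, w \in lmod /\ w \in gr g^-1%g & v ** w = f.
Proof.
case: fP => _ _ _ _ inv /rmodP[vR fv] vg v0.
have [r [rR rg] vr] := inv g v vR vg fv v0.
exists (r ** f); last by rewrite mA vr.
by rewrite mem_lmod // -[g^-1%g]mulg1 (mul_gr grA).
Qed.

(** For some homogeneous r the element d = f r w of f R f is nonzero, hence has a
    right inverse e in f R f, which is also a left inverse, as e has a right
    inverse too; so e f r is a left inverse of w. *)
Lemma lmod_left_inverse g w : w \in lmod -> w \in gr g -> w != 0 ->
  exists2 v, v \in rmod /\ v \in gr g^-1%g & v ** w = f.
Proof.
move=> wf wg w0; have [wR wfE] := (lmodP w).1 wf.
have [h [r [rR rh frw0]]] :
    exists h r, [/\ r \in R, r \in gr h & f ** r ** w != 0].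
  apply: contrapT => no; case/eqP: w0; apply: primitive_faithful => // r rR.
  rewrite -(hcomp_sum grA r) linear_sumr linear_sumlz big1 // => h _.
  apply: contrapT => /eqP nz; apply: no; exists h, (hcomp h r).
  by rewrite hR ?hcomp_mem.
pose d := f ** r ** w.
have fr : f ** r \in gr h by rewrite -[h]mul1g (mul_gr grA).
have dhg : d \in gr (h * g)%g by rewrite (mul_gr grA).
have df : d ** f = d by rewrite -mA wfE.
have dR : d \in rmod by rewrite rmodM ?mem_rmod.
have [d1 [d1f d1g] dd1] := rmod_right_inverse dR dhg frw0.
have [d1R d1fE] := (lmodP d1).1 d1f.
pose e := f ** d1.
have de : d ** e = f by rewrite mA df.
have e_neq0 : e != 0 by apply: contra_neq f_neq0 => e0; rewrite -de e0 linear0r.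
have eg : e \in gr (h * g)^-1%g by rewrite -[_^-1%g]mul1g (mul_gr grA).
have [d2 [d2f _] ed2] := rmod_right_inverse (mem_rmod d1R) eg e_neq0.
have ed : e ** d = f.
  have fd2 : f ** d2 = d by rewrite -de -mA ed2.
  have [d2R d2fE] := (lmodP d2).1 d2f.
  have ef : e ** f = e by rewrite /e -mA d1fE.
  by rewrite -fd2 mA ef ed2.
exists (e ** (f ** r)); last by rewrite -mA ed.
split; first by rewrite rmodM ?mem_rmod // RM.
by have := mul_gr grA eg fr; rewrite invMg mulgKV.
Qed.

Local Notation fr := rmod.
Local Notation lf := lmod.
Local Notation D := corner.
(** The pairing f R x R f -> f R f followed by a functional on the piece of degree 1
    that does not vanish at f is nondegenerate, and matches the degrees in C with
    their inverses. *)
Lemma dim_rmod_lmod C :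
  \dim (fr :&: gpart C) = \dim (lf :&: gpart (C^-1)%g).
Proof.
have [lam lam0] := exists_functional f_neq0.
pose psi := (lam \o hcomp 1%g)%VF.
pose bl t := (psi \o lmulv m t)%VF; pose br t := (psi \o rmulv m t)%VF.
have blr t x : bl t x = br x t by rewrite !comp_lfunE lmulvE rmulvE.
have blE t x : bl t x = lam (hcomp 1%g (t ** x)) by rewrite !comp_lfunE lmulvE.
apply/eqP; rewrite eqn_leq; apply/andP; split.
  apply: (nondegenerate_dim (fun t x => esym (blr x t))) => v /memv_capP[vf vC] v0.
  apply: contrapT => /eqP v_neq0; have [g vg0] := hcomp_neq0 grA v_neq0.
  have gC : g \in C.
    by apply: contraT => gC; rewrite ((gpartP grA C v).1 vC) ?eqxx in vg0.
  have [w [wf wg] vw] := rmod_right_inverse (homogeneous_rmod g vf) (hcomp_mem gr g v) vg0.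
  have : br w v = 0.
    by apply: v0; rewrite memv_cap wf (gr_gpart grA _ wg) // inE invgK.
  rewrite -blr blE (hcompMr grA _ _ wg) invgK mul1g vw => lam00.
  by rewrite lam00 eqxx in lam0.
apply: (nondegenerate_dim blr) => w /memv_capP[wf wC] w0.
apply: contrapT => /eqP w_neq0; have [g wg0] := hcomp_neq0 grA w_neq0.
have gC : g^-1%g \in C.
  by apply: contraT; rewrite -mem_invg => gC; rewrite ((gpartP grA _ w).1 wC) ?eqxx in wg0.
have [v [vf vg] vw] := lmod_left_inverse (homogeneous_lmod g wf) (hcomp_mem gr g w) wg0.
have : bl v w = 0.
  by apply: w0; rewrite memv_cap vf (gr_gpart grA _ vg).
rewrite blE (hcompMl grA _ _ vg) invgK mulg1 vw => lam00.
by rewrite lam00 eqxx in lam0.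
Qed.

Lemma corner_left_inverse g d : d \in D -> d \in gr g -> d != 0 ->
  exists2 e, e \in D & e ** d = f.
Proof.
case/memv_capP=> dr dl dg d0.
have [v [vf _] vd] := lmod_left_inverse dl dg d0.
have [[vR vfE] [dR dfE]] := ((rmodP v).1 vf, (rmodP d).1 dr).
exists (v ** f); last by rewrite -mA dfE.
by rewrite memv_cap rmodM // mem_lmod.
Qed.

(** Over the graded division algebra D a homogeneous v outside a graded submodule E
    is independent of E: a nonzero homogeneous component of d can be inverted. *)
Lemma corner_free E g v : homogeneous E -> (mulv m D E <= E)%VS ->
  v \in fr -> v \in gr g -> v \notin E ->
  forall d, d \in D -> d ** v \in E -> d = 0.
Proof.
move=> hE DE vf vg vE d dD dvE; apply: contrapT => /eqP d0.
have [h dh0] := hcomp_neq0 grA d0.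
have [e eD ed] := corner_left_inverse (homogeneous_corner h dD) (hcomp_mem gr h d) dh0.
case/negP: vE; have <- : e ** (hcomp h d ** v) = v.
  by rewrite mA ed; have [_] := (rmodP v).1 vf.
rewrite (subvP DE) ?mem_mulv //.
have := hcompMr grA (h * g)%g d vg; rewrite mulgK => <-.
exact: hE.
Qed.

Let dimM x U : (\dim (rmulv m x @: U) <= \dim U)%N.
Proof. by rewrite -(limg_ker_dim (rmulv m x) U) leq_addl. Qed.

(** Here E is the D-span of a maximal D-independent family v_1, ..., v_r of
    homogeneous elements of f R of degrees in C. Then dim E = r dim D; the sum of
    the spaces W v_i is direct with summands of dimension dim W; and R f E is the
    sum of the spaces R f v_i. *)
Lemma corner_basis C :
  exists r (E : {vspace A}), [/\ (E <= fr)%VS, (fr :&: gpart C <= E)%VS,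
    \dim E = (r * \dim D)%N,
    (r * \dim (lf :&: gpart C^-1%g)
       <= \dim (mulv m (lf :&: gpart C^-1%g) (fr :&: gpart C)))%N
    & (\dim (mulv m lf E) <= r * \dim lf)%N].
Proof.
set V := (fr :&: gpart C)%VS; set W := (lf :&: gpart C^-1%g)%VS.
have hV : homogeneous V.
  by apply: homogeneous_cap; [apply: homogeneous_rmod | apply: (homogeneous_gpart grA)].
suff [r [E [M [Efr VE dE [MWV dM] dlE]]]] : exists r (E M : {vspace A}),
    [/\ (E <= fr)%VS, (V <= E)%VS, \dim E = (r * \dim D)%N,
      (M <= mulv m W V)%VS /\ \dim M = (r * \dim W)%N
    & (\dim (mulv m lf E) <= r * \dim lf)%N].
  by exists r, E; split=> //; rewrite -dM dimvS.
(* The family is extended one element at a time; M is the sum of the W v_i, and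
   f R M <= E is what makes the next summand W v independent of it. *)
suff build n r (E M : {vspace A}) : (\dim fr - \dim E < n)%N ->
    homogeneous E -> (mulv m D E <= E)%VS -> (mulv m fr M <= E)%VS ->
    (E <= fr)%VS -> \dim E = (r * \dim D)%N ->
    (M <= mulv m W V)%VS -> \dim M = (r * \dim W)%N ->
    (\dim (mulv m lf E) <= r * \dim lf)%N ->
    exists r (E M : {vspace A}),
    [/\ (E <= fr)%VS, (V <= E)%VS, \dim E = (r * \dim D)%N,
      (M <= mulv m W V)%VS /\ \dim M = (r * \dim W)%N
    & (\dim (mulv m lf E) <= r * \dim lf)%N].
  have mul0 U : (mulv m U 0 <= 0)%VS.
    by apply/mulv_subP => u v _; rewrite memv0 => /eqP ->; rewrite linear0r mem0v.
  apply: (build _ 0%N 0%VS 0%VS (ltnSn _)); rewrite ?dimv0 ?sub0v //.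
    exact: homogeneous0.
  by rewrite leqn0 dimv_eq0 -subv0.
elim: n r E M => // n IHn r E M dn hE DE frM Efr dE MWV dM dlE.
have [VE|] := boolP (V <= E)%VS; first by exists r, E, M.
case/subvPn=> x xV xE.
have [g vE] : exists g, hcomp g x \notin E.
  apply: contrapT => no; case/negP: xE; rewrite -(hcomp_sum grA x) memv_suml // => g _.
  by apply: contrapT => /negP xg; apply: no; exists g.
pose v := hcomp g x.
have vg : v \in gr g by apply: hcomp_mem.
have [vf vC] : v \in fr /\ v \in gpart C by apply/memv_capP/hV.
have [vR fv] := (rmodP v).1 vf.
have free := corner_free hE DE vf vg vE.
have D_rmul_dim : \dim (rmulv m v @: D) = \dim D.
  apply: limg_dim_eq; apply/eqP; rewrite -subv0; apply/subvP => d.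
  rewrite memv_cap memv_ker rmulvE memv0 => /andP[dD /eqP dv0]; apply/eqP; apply: (free) => //.
  by rewrite dv0 mem0v.
have ED0 : (E :&: rmulv m v @: D = 0)%VS.
  apply/eqP; rewrite -subv0; apply/subvP => y /memv_capP[yE /memv_imgP[d dD Dy]].
  by move: yE; rewrite Dy rmulvE => /free -> //; rewrite linear0l mem0v.
have Wfree w : w \in W -> (forall u, u \in fr -> u ** w ** v \in E) -> w = 0.
  case/memv_capP=> wl _ uwE; have [wR wf] := (lmodP w).1 wl.
  apply: primitive_faithful => // r1 r1R.
  apply: free; first by rewrite cornerM ?mem_rmod.
  by rewrite uwE ?mem_rmod.
have frMP u y : u \in fr -> y \in M -> u ** y \in E.
  by move=> uf yM; rewrite (subvP frM) ?mem_mulv.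
have W_rmul_dim : \dim (rmulv m v @: W) = \dim W.
  apply: limg_dim_eq; apply/eqP; rewrite -subv0; apply/subvP => w.
  rewrite memv_cap memv_ker rmulvE memv0 => /andP[wW /eqP wv0]; apply/eqP; apply: (Wfree) => //.
  by move=> u _; rewrite -mA wv0 linear0r mem0v.
have MW0 : (M :&: rmulv m v @: W = 0)%VS.
  apply/eqP; rewrite -subv0; apply/subvP => y /memv_capP[yM /memv_imgP[w wW Dy]].
  move: yM; rewrite Dy rmulvE => wvM; rewrite [w]Wfree ?linear0l ?mem0v // => u uf.
  by rewrite -mA frMP.
apply: (IHn r.+1 (E + rmulv m v @: D)%VS (M + rmulv m v @: W)%VS).
- rewrite dimv_disjoint_sum // D_rmul_dim.
  apply: leq_ltn_trans (_ : (\dim fr - \dim E).-1 < n)%N.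
    rewrite -subnS leq_sub2l // -addn1 leq_add2l lt0n dimv_eq0.
    apply: contra_neq f_neq0 => D0; apply/eqP; rewrite -memv0 -D0 memv_cap.
    by apply/andP; split; [apply/rmodP | apply/lmodP].
  have EltE : (\dim E < \dim fr)%N.
    rewrite ltnNge; apply: contra vE => le.
    by have /eqP -> : E == fr by rewrite eqEdim Efr.
  by rewrite -subn_gt0 in EltE; rewrite -(prednK EltE) in dn.
- apply: homogeneous_add => //; exact: homogeneous_limg_rmulv vg homogeneous_corner.
- apply/mulv_subP => d y dD /memv_addP[e eE [_ /memv_imgP[d1 d1D ->] ->]].
  rewrite linearDr /= memv_add //; first by rewrite (subvP DE) ?mem_mulv.
  rewrite rmulvE mA -rmulvE memv_img //.
  have [[d0 _] [_ d1l]] := (memv_capP dD, memv_capP d1D).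
  by rewrite cornerM.
- apply/mulv_subP => u y uf /memv_addP[e eM [_ /memv_imgP[w wW ->] ->]].
  rewrite linearDr /= memv_add ?frMP // rmulvE mA -rmulvE memv_img //.
  by have [wl _] := memv_capP wW; rewrite cornerM.
- rewrite subv_add Efr; apply/subvP => _ /memv_imgP[d /memv_capP[df _] ->].
  by rewrite rmulvE rmodM.
- by rewrite dimv_disjoint_sum // D_rmul_dim dE mulSn addnC.
- rewrite subv_add MWV; apply/subvP => _ /memv_imgP[w wW ->].
  by rewrite rmulvE mem_mulv // memv_cap vf.
- by rewrite dimv_disjoint_sum // W_rmul_dim dM mulSn addnC.
apply: (@leq_trans (\dim (mulv m lf E + rmulv m v @: lf))%N).
  apply/dimvS/mulv_subP => l y ll /memv_addP[e eE [_ /memv_imgP[d dD ->] ->]].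
  rewrite linearDr /= memv_add ?mem_mulv // rmulvE mA -rmulvE memv_img //.
  have [_ dl] := memv_capP dD; have [lR _] := (lmodP l).1 ll.
  exact: lmodM.
apply: leq_trans (dimv_add_leqif _ _).1 _.
by rewrite mulSn addnC leq_add ?dimM.
Qed.

(** With r independent elements in V of degrees in C: dim V <= r dim D, and W V has
    dimension at least r dim W = r dim V. *)
Lemma corner_dim_lower C :
  (\dim (fr :&: gpart C) ^ 2
     <= \dim D * \dim (mulv m (lf :&: gpart C^-1%g) (fr :&: gpart C)))%N.
Proof.
have [r [E [_ /dimvS VE dE lower _]]] := corner_basis C.
rewrite -mulnn {2}dim_rmod_lmod.
apply: leq_trans (leq_mul VE (leqnn _)) _; rewrite dE [(r * _)%N]mulnC -mulnA.
by rewrite leq_mul2l lower orbT.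
Qed.

(** With r elements forming a D-basis of f R: dim f R = r dim D, and R = R f R has
    dimension at most r dim R f = r dim f R. *)
Lemma corner_dim_upper : (\dim D * \dim R <= \dim fr ^ 2)%N.
Proof.
have frT : (fr :&: gpart [set: gT] = fr)%VS.
  by apply/capv_idPl; rewrite (gpart_setT grA) subvf.
have lfT : (lf :&: gpart [set: gT]^-1%g = lf)%VS.
  apply/capv_idPl/subvP => x _; apply/(gpartP grA) => g.
  by rewrite !inE.
have := dim_rmod_lmod [set: gT]; rewrite frT lfT => frlf.
have [r [E []]] := corner_basis [set: gT]; rewrite frT lfT => Efr frE dE _ upper.
have /eqP EE : E == fr by rewrite eqEsubv Efr.
rewrite EE in dE upper.
rewrite -mulnn {1}dE [(r * _)%N]mulnC -mulnA leq_mul2l frlf.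
apply/orP; right; apply: leq_trans upper; apply/dimvS.
apply: mulv_RfR_sub => x y xR yR.
by rewrite -ff mA -mA mem_mulv ?mem_rmod ?mem_lmod.
Qed.

End Primitive.

(** * Components over a subgroup *)

Lemma lcosetV_mul (gT : finGroupType) (K : {group gT}) (h g1 g2 : gT) :
  g1 \in (h *: K)^-1%g -> g2 \in (h *: K)%g -> (g1 * g2)%g \in K.
Proof.
rewrite mem_invg !mem_lcoset => g1K g2K.
suff -> : (g1 * g2 = (h^-1 * g1^-1)^-1 * (h^-1 * g2))%g by rewrite groupM ?groupV.
by rewrite invMg !invgK mulgA mulgK.
Qed.

Section Subgroup.
Variables (F : closedFieldType) (A : vectType F) (m : {bilinear A -> A -> A}).
Variables (gT : finGroupType) (gr : gT -> {vspace A}).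
Hypothesis charF0 : [pchar F] =i pred0.
Hypothesis mA : associative m.
Hypothesis grA : is_grading m gr.
Local Notation "x ** y" := (m x y) (at level 40, left associativity).
Local Notation hcomp := (hcomp gr).
Local Notation homogeneous := (homogeneous gr).
Local Notation gpart := (gpart gr).
Implicit Types (I T U V W : {vspace A}) (x y z : A) (g h : gT) (C : {set gT}).

Variable K : {group gT}.
Local Notation J := (jacobson m fullv).
Local Notation AK := (gpart K).
Local Notation JK := (jacobson m AK).

Lemma subalgebra_fullv : subalgebra m fullv.
Proof. exact: subvf. Qed.

Lemma subalgebra_group_part : subalgebra m AK.
Proof. by apply/mulv_subP => x y; apply: gpart_groupM. Qed.

Lemma homogeneous_radical : homogeneous J.
Proof.
by apply: homogeneous_jacobson => //; [apply: subalgebra_fullv | apply: homogeneousf].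
Qed.

Lemma jacobson_group_part : JK = (J :&: AK)%VS.
Proof.
rewrite -[X in jacobson m X]capfv (jacobson_gpart charF0 mA grA) //.
  exact: subalgebra_fullv.
exact: homogeneousf.
Qed.

Lemma J_ideal x y : y \in J -> x ** y \in J /\ y ** x \in J.
Proof. by move=> yJ; apply: jacobsonM (memvf x) yJ => //; apply: subalgebra_fullv. Qed.

Variable S : {vspace A}.
Hypothesis wmS : graded_wedderburn_malcev m gr [set: gT]%G fullv S.

Let mS : subalgebra m S. Proof. by case: wmS. Qed.
Let hS : homogeneous S. Proof. by case: wmS => _ /(gradedTP grA). Qed.
Let SJ0 : (S :&: J)%VS = 0%VS. Proof. by case: wmS. Qed.
Let SJ1 : (S + J)%VS = fullv. Proof. by case: wmS. Qed.

(** Both S and J are graded, so the decomposition of an element of A_K can be taken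
    degree by degree, and [jacobson_gpart] applies to S as well as to A. *)
Lemma graded_wedderburn_malcev_subgroup :
  graded_wedderburn_malcev m gr K AK (S :&: AK).
Proof.
split.
- exact: subalgebra_gpart.
- apply/(gradedP grA); rewrite capvSr; split=> //.
  by apply: homogeneous_cap => //; apply: (homogeneous_gpart grA).
- rewrite /semisimple (jacobson_gpart charF0 mA grA) //.
  by case: wmS => _ _ -> _ _; rewrite cap0v.
- rewrite jacobson_group_part; apply/eqP; rewrite eqEsubv subv_add !capvSr /=.
  apply/subvP => x /(gpartP grA) xK; rewrite -(hcomp_sum grA x) memv_suml // => g _.
  have [gK|/xK ->] := boolP (g \in K); last exact: mem0v.
  have : x \in (S + J)%VS by rewrite SJ1 memvf.
  case/memv_addP => s sS [y yJ ->]; rewrite linearD.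
  by rewrite memv_add // memv_cap ?hS ?homogeneous_radical //= (gr_gpart grA gK) ?hcomp_mem.
by rewrite jacobson_group_part; apply/eqP; rewrite -subv0 -SJ0 capvS ?capvSl.
Qed.

Variables (S' : {vspace A}) (Ts' : seq {vspace A}).
Hypothesis wmS' : graded_wedderburn_malcev m gr K AK S'.
Hypothesis dS' : graded_simple_decomposition m gr K S' Ts'.

Let mS' : subalgebra m S'. Proof. by case: wmS'. Qed.
Let SJK' : (S' + JK)%VS = AK. Proof. by case: wmS'. Qed.
Let S'J0 : (S' :&: JK)%VS = 0%VS. Proof. by case: wmS'. Qed.
Let JK_ideal x y : x \in AK -> y \in JK -> x ** y \in JK /\ y ** x \in JK.
Proof. by move=> xK yJ; apply: jacobsonM xK yJ => //; apply: subalgebra_group_part. Qed.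
Let JK_sub : (JK <= AK)%VS. Proof. exact: jacobson_sub subalgebra_group_part. Qed.
Let hJK : homogeneous JK.
Proof.
by apply: (homogeneous_jacobson charF0 mA grA subalgebra_group_part); apply: (homogeneous_gpart grA).
Qed.

Let decK' a : a \in AK -> exists s b, [/\ s \in S', b \in JK & a = s + b].
Proof. by rewrite -{1}SJK' => /memv_addP[s sS [b bJ ->]]; exists s, b. Qed.

Section Component.
Variables (R : {vspace A}) (f : A) (h : gT).
Hypothesis iR : ideal_of m S R.
Hypothesis sR : graded_simple m gr [set: gT]%G R.
Hypothesis fP : graded_primitive m gr R f.
Local Notation hK := (h *: K)%g.
Local Notation V := (rmod m R f :&: gpart hK)%VS.
Local Notation W := (lmod m R f :&: gpart hK^-1%g)%VS.
Local Notation P := (mulv m W V + JK)%VS.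
Hypothesis V0 : V <> 0%VS.

Let RS : (R <= S)%VS. Proof. by case: iR. Qed.
Let hV : homogeneous V.
Proof.
apply: homogeneous_cap; last exact: (homogeneous_gpart grA).
exact: (homogeneous_rmod grA sR fP).
Qed.
Let hW : homogeneous W.
Proof.
apply: homogeneous_cap; last exact: (homogeneous_gpart grA).
exact: (homogeneous_lmod grA sR fP).
Qed.
Let fR : f \in R. Proof. by case: fP. Qed.
Let f1 : f \in gr 1%g. Proof. by case: fP. Qed.
Let ff : f ** f = f. Proof. by case: fP. Qed.
Let f_neq0 : f != 0. Proof. by case: fP. Qed.
Let rmodP x : x \in rmod m R f <-> x \in R /\ f ** x = x.
Proof. exact: (rmodP mA sR fP). Qed.
Let lmodP x : x \in lmod m R f <-> x \in R /\ x ** f = x.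
Proof. exact: (lmodP mA sR fP). Qed.

Let hKV g1 g2 : g1 \in hK^-1%g -> g2 \in hK -> (g1 * g2)%g \in K.
Proof. exact: lcosetV_mul. Qed.

Let KhK k g : k \in K -> g \in hK -> (g * k)%g \in hK.
Proof. by move=> kK; rewrite !mem_lcoset mulgA => gK; rewrite groupM. Qed.

Let KhKV k g : k \in K -> g \in hK^-1%g -> (k * g)%g \in hK^-1%g.
Proof. by move=> kK; rewrite !mem_invg invMg => gK; rewrite KhK ?groupV. Qed.

Let WV_AK w v : w \in gpart hK^-1%g -> v \in gpart hK -> w ** v \in AK.
Proof. exact: (gpartM grA). Qed.

Let WV_sub : (mulv m W V <= R :&: AK)%VS.
Proof.
apply/mulv_subP => w v /memv_capP[/lmodP[wR _] wK] /memv_capP[/rmodP[vR _] vK].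
by rewrite memv_cap WV_AK // andbT; case: sR => mR _ _ _; apply: subalgebraM.
Qed.

Let JK_J y : y \in JK -> y \in J /\ y \in AK.
Proof. by rewrite jacobson_group_part => /memv_capP. Qed.

Let SJ_eq x : x \in S -> x \in J -> x = 0.
Proof. by move=> xS xJ; apply/eqP; rewrite -memv0 -SJ0 memv_cap xS. Qed.

Let P_ideal : ideal_of m AK P.
Proof.
have decK a : a \in AK -> exists s b, [/\ s \in S, s \in AK, b \in JK & a = s + b].
  have [_ _ _ sumK _] := graded_wedderburn_malcev_subgroup.
  rewrite -{1}sumK => /memv_addP[s /memv_capP[sS sK] [b bJ ->]].
  by exists s, b.
have [_ lR rR] := iR.
have WV_AK' w v : w \in W -> v \in V -> w ** v \in AK.
  by move=> /memv_capP[_ wK] /memv_capP[_ vK]; apply: WV_AK.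
split.
- by rewrite subv_add JK_sub andbT (subv_trans WV_sub) ?capvSr.
- apply/mulv_subP => a x aK /memv_addP[y yWV [z zJ ->]]; rewrite linearDr /=.
  rewrite memvD //; last first.
    by rewrite (subvP (addvSr _ _)) //; have [] := JK_ideal aK zJ.
  rewrite -lmulvE memv_preim; apply: (subvP _ _ yWV); apply/mulv_subP => w v wW vV.
  rewrite -memv_preim lmulvE; have [s [b [sS sK bJ ->]]] := decK a aK.
  rewrite linearDl /= memv_add //; last first.
    by have [] := JK_ideal (WV_AK' _ _ wW vV) bJ.
  rewrite mA mem_mulv //; have [/lmodP[wR wf] wK] := memv_capP wW.
  rewrite memv_cap; apply/andP; split.
    by apply/lmodP; rewrite -mA wf (subvP lR) ?mem_mulv.
  exact: gpartM KhKV sK wK.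
apply/mulv_subP => x a /memv_addP[y yWV [z zJ ->]] aK; rewrite linearDl /=.
rewrite memvD //; last first.
  by rewrite (subvP (addvSr _ _)) //; have [] := JK_ideal aK zJ.
rewrite -rmulvE memv_preim; apply: (subvP _ _ yWV); apply/mulv_subP => w v wW vV.
rewrite -memv_preim rmulvE; have [s [b [sS sK bJ ->]]] := decK a aK.
rewrite linearDr /= memv_add //; last first.
  by have [] := JK_ideal (WV_AK' _ _ wW vV) bJ.
rewrite -mA mem_mulv //; have [/rmodP[vR fv] vK] := memv_capP vV.
rewrite memv_cap; apply/andP; split.
  by apply/rmodP; rewrite mA fv (subvP rR) ?mem_mulv.
apply: (gpartM grA _ vK sK) => g1 g2 g1K g2K; exact: KhK.
Qed.

Let hP : homogeneous P.
Proof. by apply: homogeneous_add => //; apply: homogeneous_mul. Qed.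

(** A nonzero homogeneous s in W V is already detected by V: some u in f R has
    u s != 0, hence some homogeneous w in W has d = u w != 0; the element v with
    d v = u has degree in hK, and v s != 0. *)
Let WV_detect g s : s \in mulv m W V -> s \in gr g -> s != 0 ->
  exists v g1, [/\ v \in V, v \in gr g1, g1 \in hK & v ** s != 0].
Proof.
move=> sWV sg s0; have /memv_capP[sinR _] := subvP WV_sub _ sWV.
have hR : homogeneous R by case: sR => _ /(gradedTP grA).
have [g2 [r [rR rg us0]]] :
    exists g2 r, [/\ r \in R, r \in gr g2 & f ** r ** s != 0].
  apply: contrapT => no; case/eqP: s0.
  apply: (primitive_faithful mA grA sR fP) => // r rR.
  rewrite -(hcomp_sum grA r) linear_sumr linear_sumlz big1 // => k _.
  apply: contrapT => /eqP nz; apply: no; exists k, (hcomp k r).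
  by rewrite hR ?hcomp_mem.
pose u := f ** r.
have uR : u \in rmod m R f by apply: mem_rmod.
have ug : u \in gr g2 by rewrite -[g2]mul1g (mul_gr grA).
have [g3 [w [wW wg d0]]] : exists g3 w, [/\ w \in W, w \in gr g3 & u ** w != 0].
  apply: contrapT => no; case/eqP: us0; apply/eqP.
  rewrite -lmulvE -memv_ker; apply: (subvP _ _ sWV); apply/mulv_subP => w v wW _.
  rewrite memv_ker lmulvE mA -(hcomp_sum grA w) linear_sumr linear_sumlz big1 // => k _.
  apply: contrapT => /eqP nz; apply: no; exists k, (hcomp k w).
  rewrite hW ?hcomp_mem //; split=> //.
  by apply: contra_neq nz => ->; rewrite linear0l.
have [wl wK] := memv_capP wW; have [wR wf] := (lmodP w).1 wl.
pose d := u ** w.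
have w_neq0 : w != 0 by apply: contra_neq d0 => ->; rewrite linear0r.
have g3K : g3 \in hK^-1%g.
  apply: contraT => g3K; case/negP: w_neq0; apply/eqP.
  by rewrite -((gpartP grA _ w).1 wK g3 g3K) (hcomp_id grA _ wg) eqxx.
have dr : d \in rmod m R f by apply: (rmodM mA sR fP).
have dg : d \in gr (g2 * g3)%g by apply: mul_gr.
have [e [el eg] de] := rmod_right_inverse mA grA sR fP dr dg d0.
have [eR ef] := (lmodP e).1 el.
pose v := f ** e ** u.
have dv : d ** v = u.
  have df : d ** f = d by rewrite /d -mA wf.
  have [_ fu] := (rmodP u).1 uR.
  by rewrite /v (mA d _ u) (mA d f e) df de fu.
have fe : f ** e \in rmod m R f by apply: mem_rmod.
have vr : v \in rmod m R f.
  by apply: (rmodM mA sR fP) => //; have [] := (rmodP u).1 uR.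
have vg : v \in gr g3^-1%g.
  have := mul_gr grA (mul_gr grA f1 eg) ug.
  by rewrite mul1g invMg mulgKV.
exists v, g3^-1%g; split=> //; last 2 first.
- by rewrite -mem_invg.
- by apply: contra_neq us0 => vs0; rewrite -/u -dv -mA vs0 linear0r.
by rewrite memv_cap vr (gr_gpart grA _ vg) // -mem_invg.
Qed.

(** A graded ideal Q strictly above the radical contains a nonzero homogeneous s of
    W V; with v s w1 = f for suitable v in V and w1 in W, every product w v0 of W
    and V equals (w v) s (w1 v0), whose outer factors lie in A_K. *)
Let P_minimal Q : ideal_of m AK Q -> homogeneous Q -> (JK <= Q)%VS ->
  (Q <= P)%VS -> Q <> JK -> (P <= Q)%VS.
Proof.
move=> iQ hQ JQ QP QJ.
have [y yQ yJ] : exists2 y, y \in Q & y \notin JK.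
  by apply/subvPn; apply/negP => QJ'; apply: QJ; apply/eqP; rewrite eqEsubv QJ'.
have [g ygJ] : exists g, hcomp g y \notin JK.
  apply: contrapT => no; case/negP: yJ; rewrite -(hcomp_sum grA y) memv_suml // => g _.
  by apply: contrapT => /negP xg; apply: no; exists g.
have ygQ : hcomp g y \in Q by apply: hQ.
have /memv_addP[s0 s0WV [j0 j0J Dy]] := subvP QP _ ygQ.
have hWV : homogeneous (mulv m W V) by apply: homogeneous_mul.
pose s := hcomp g s0.
have sg : s \in gr g by apply: hcomp_mem.
have Dyg : hcomp g y = s + hcomp g j0.
  by have := congr1 (hcomp g) Dy; rewrite linearD /= (hcomp_hcomp grA) eqxx.
have sWV : s \in mulv m W V by apply: hWV.
have jJ : hcomp g j0 \in JK by apply: hJK.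
have s_neq0 : s != 0 by apply: contraNneq ygJ => s00; rewrite Dyg s00 add0r.
have sQ : s \in Q.
  by rewrite -[s](addrK (hcomp g j0)) -Dyg memvB // (subvP JQ).
have [v [g1 [vV vg g1K vs0]]] := WV_detect sWV sg s_neq0.
have [vr vK] := memv_capP vV; have [vR fv] := (rmodP v).1 vr.
have /memv_capP[sinR sK] := subvP WV_sub _ sWV.
have gK : g \in K.
  apply: contraT => gK; case/negP: s_neq0; apply/eqP.
  by rewrite -((gpartP grA _ s).1 sK g gK) (hcomp_id grA _ sg) eqxx.
have xr : v ** s \in rmod m R f by apply: (rmodM mA sR fP).
have [w1 [w1l w1g] xw] := rmod_right_inverse mA grA sR fP xr (mul_gr grA vg sg) vs0.
rewrite subv_add JQ andbT; apply/mulv_subP => w v0 wW v0V.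
have [[wl wK] [v0r v0K]] := (memv_capP wW, memv_capP v0V).
have [[wR wf] [v0R fv0]] := ((lmodP w).1 wl, (rmodP v0).1 v0r).
have -> : w ** v0 = (w ** v) ** s ** (w1 ** v0).
  by rewrite -{1}wf -xw !mA.
have w1v0 : w1 ** v0 \in AK.
  apply: WV_AK => //; apply: (gr_gpart grA _ w1g).
  by rewrite mem_invg invgK KhK.
have wvK : w ** v \in AK by apply: WV_AK.
have [_ wvs _] := ideal_ofM iQ wvK sQ.
by have [_ _] := ideal_ofM iQ w1v0 wvs.
Qed.

Let exists_pair : exists v w h1,
  [/\ h1 \in hK, v \in V /\ v \in gr h1, w \in W /\ w \in gr h1^-1%g & v ** w = f].
Proof.
have [x xV x0] : exists2 x, x \in V & x != 0.
  by exists (vpick V); rewrite ?memv_pick ?vpick0; apply/eqP.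
have [h1 v0] := hcomp_neq0 grA x0.
have vV : hcomp h1 x \in V by apply: hV.
have [vr vK] := memv_capP vV.
have h1K : h1 \in hK.
  apply: contraT => h1K; case/negP: v0; apply/eqP.
  have := (gpartP grA _ _).1 vK h1 h1K.
  by rewrite (hcomp_hcomp grA) eqxx.
have [w [wl wg] vw] := rmod_right_inverse mA grA sR fP vr (hcomp_mem gr h1 x) v0.
exists (hcomp h1 x), w, h1; rewrite vV hcomp_mem memv_cap wl wg; split=> //.
by rewrite (gr_gpart grA _ wg) // mem_invg invgK.
Qed.

(** The ideal P = W V + J_K is minimal above the radical J_K of A_K, and every
    chosen complement S' meets it in an ideal; so P = T + J_K for a component T of
    S'. The last clause produces an idempotent w v of W V in the ideal generated by
    T: modulo that ideal it is an element of J_K, hence nilpotent. It replaces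
    conjugating the two complements. *)
Lemma component_correspondence : exists j : 'I_(size Ts'),
  [/\ \dim (component Ts' j) = \dim (mulv m W V),
      (component Ts' j <= R + J)%VS &
      exists v w h1, [/\ h1 \in hK, v \in rmod m R f /\ v \in gr h1,
        w \in lmod m R f /\ w \in gr h1^-1%g, v ** w = f &
        w ** v \in mulv m (mulv m AK (component Ts' j)) AK]].
Proof.
have [v [w [h1 [h1K [vV vg] [wW wg] vw]]]] := exists_pair.
have [[vr vK] [wl wK]] := (memv_capP vV, memv_capP wW).
have [[vR fv] [wR wf]] := ((rmodP v).1 vr, (lmodP w).1 wl).
pose eps := w ** v.
have epsWV : eps \in mulv m W V by apply: mem_mulv.
have /memv_capP[epsR epsK] := subvP WV_sub _ epsWV.
have eps_id : eps ** eps = eps by rewrite /eps mA -(mA w) vw wf.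
have eps_neq0 : eps != 0.
  apply: contra_neq f_neq0 => e0; have : v ** eps ** w = f by rewrite mA vw -mA vw ff.
  by rewrite e0 linear0r linear0l => <-.
have epsP : eps \in P by rewrite (subvP (addvSl _ _)).
have [iP_sub iP_l iP_r] := P_ideal.
have [sTs' dTs' Ts'P] := dS'.
have S'K : (S' <= AK)%VS by rewrite -[X in (_ <= X)%VS]SJK' addvSl.
have [s' [y [s'S yJ Deps]]] := decK' epsK.
have s'P : s' \in P.
  by rewrite -[s'](addrK y) -Deps memvB // (subvP (addvSr _ _)).
(* Otherwise s' annihilates itself, and eps = eps^2 lies in the radical. *)
have [j [t tT ts0]] : exists j : 'I_(size Ts'),
    exists2 t, t \in component Ts' j & t ** s' != 0.
  apply: contrapT => no; case/eqP: eps_neq0.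
  apply: (jacobson_idempotent charF0 mA subalgebra_group_part) => //.
  rewrite -eps_id {1}Deps linearDl /= memvD //; last first.
    by have [] := JK_ideal epsK yJ.
  rewrite Deps linearDr /= memvD //; last first.
    by have [] := JK_ideal (subvP S'K _ s'S) yJ.
  suff -> : s' ** s' = 0 by rewrite mem0v.
  move: (s'S); rewrite -{1}sTs' => /memv_sumP[ts tsT Ds'].
  rewrite {1}Ds' linear_sumlz big1 // => j _.
  by apply: contrapT => /eqP nz; apply: no; exists j, (ts j); rewrite ?tsT.
exists j; set T := component Ts' j in tT *.
have [iT sT] : ideal_of m S' T /\ graded_simple m gr K T := Ts'P j.
have [TS' lT rT] := iT; have [mT /(gradedP grA)[hT TK] TT0 simT] := sT.
have TJ0 : (T :&: JK = 0)%VS.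
  by apply/eqP; rewrite -subv0 -S'J0 capvS.
have TP : (T <= P)%VS.
  suff <- : (T :&: P)%VS = T by exact: capvSr.
  have tsTP : t ** s' \in (T :&: P)%VS.
    rewrite memv_cap (subvP rT) ?mem_mulv //=.
    by rewrite (subvP iP_l) ?mem_mulv // (subvP TK).
  have [TP0|//] : (T :&: P)%VS = 0%VS \/ (T :&: P)%VS = T.
    apply: simT; last first.
      by apply/(gradedP grA); split; [apply: homogeneous_cap|apply: subv_trans (capvSl _ _) TK].
    split; first exact: capvSl.
      apply/mulv_subP => b x bT /memv_capP[xT xP].
      by rewrite memv_cap subalgebraM //= (subvP iP_l) ?mem_mulv // (subvP TK).
    apply/mulv_subP => x b /memv_capP[xT xP] bT.
    by rewrite memv_cap subalgebraM //= (subvP iP_r) ?mem_mulv // (subvP TK).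
  by case/negP: ts0; rewrite -memv0 -TP0.
have T_neq0 : T <> 0%VS.
  move=> T0; apply: TT0; apply/eqP; rewrite -subv0 T0; apply/mulv_subP => a b.
  by rewrite memv0 => /eqP -> _; rewrite linear0l mem0v.
have PTJ : P = (T + JK)%VS.
  apply/eqP; rewrite eqEsubv andbC subv_add TP addvSr /=.
  apply: P_minimal.
  - split; first by rewrite subv_add TK JK_sub.
      apply/mulv_subP => a x aK /memv_addP[b bT [z zJ ->]]; rewrite linearDr /=.
      rewrite memvD //; last by rewrite (subvP (addvSr _ _)) //; have [] := JK_ideal aK zJ.
      have [a1 [a2 [a1S a2J ->]]] := decK' aK.
      rewrite linearDl /= memv_add //; first by rewrite (subvP lT) ?mem_mulv.
      by have [] := JK_ideal (subvP TK _ bT) a2J.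
    apply/mulv_subP => x a /memv_addP[b bT [z zJ ->]] aK; rewrite linearDl /=.
    rewrite memvD //; last by rewrite (subvP (addvSr _ _)) //; have [] := JK_ideal aK zJ.
    have [a1 [a2 [a1S a2J ->]]] := decK' aK.
    rewrite linearDr /= memv_add //; first by rewrite (subvP rT) ?mem_mulv.
    by have [] := JK_ideal (subvP TK _ bT) a2J.
  - exact: homogeneous_add.
  - exact: addvSr.
  - by rewrite subv_add TP addvSr.
  move=> TJ; apply: T_neq0; apply/eqP; rewrite -subv0 -TJ0 subv_cap subvv /=.
  by rewrite -TJ addvSl.
split.
- have WVJ0 : (mulv m W V :&: JK = 0)%VS.
    apply/eqP; rewrite -subv0; apply/subvP => x /memv_capP[xWV xJ].
    have /memv_capP[xR _] := subvP WV_sub _ xWV.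
    by rewrite memv0; apply/eqP/SJ_eq; [apply: (subvP RS) | have [] := JK_J xJ].
  by have := congr1 (fun X : {vspace A} => \dim X) PTJ;
     rewrite !dimv_disjoint_sum // => /addIn.
- apply: subv_trans TP _; rewrite addvS //; first exact: subv_trans WV_sub (capvSl _ _).
  by apply/subvP => x /JK_J[].
exists v, w, h1; split=> //; rewrite -/eps; set X := mulv m _ AK.
have TTT : mulv m T T = T.
  have [//|//] : mulv m T T = 0%VS \/ mulv m T T = T.
  apply: simT; last first.
    apply/(gradedP grA); split; first exact: homogeneous_mul.
    exact: subv_trans mT TK.
  split=> //; apply/mulv_subP => a b aT bT.
    by rewrite mem_mulv // (subvP mT).
  by rewrite mem_mulv // (subvP mT).
have TX : (T <= X)%VS.
  rewrite -{1}TTT; apply/mulv_subP => a b aT bT; rewrite mem_mulv ?(subvP TK) //.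
  move: aT; rewrite -{1}TTT; apply: subvP; apply/mulv_subP => a1 a2 a1T a2T.
  by rewrite mem_mulv ?(subvP TK).
have XlM a x : a \in AK -> x \in X -> a ** x \in X.
  move=> aK xX; rewrite -lmulvE memv_preim; apply: (subvP _ _ xX).
  apply/mulv_subP => b c bAT cK; rewrite -memv_preim lmulvE mA mem_mulv //.
  rewrite -lmulvE memv_preim; apply: (subvP _ _ bAT); apply/mulv_subP => b1 b2 b1K b2T.
  by rewrite -memv_preim lmulvE mA mem_mulv // (subvP subalgebra_group_part) ?mem_mulv.
have XrM a x : a \in AK -> x \in X -> x ** a \in X.
  move=> aK xX; rewrite -rmulvE memv_preim; apply: (subvP _ _ xX).
  apply/mulv_subP => b c bAT cK; rewrite -memv_preim rmulvE -mA mem_mulv //.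
  by rewrite (subvP subalgebra_group_part) ?mem_mulv.
have : eps \in (T + JK)%VS by rewrite -PTJ.
case/memv_addP=> b bT [z zJ Dz].
have zK : z \in AK by apply: (subvP JK_sub).
(* Modulo the ideal X the idempotent eps is congruent to every power of z. *)
have modX n : iter n (rmulv m z) z \in AK /\ eps - iter n (rmulv m z) z \in X.
  elim: n => [|n [nK nX]] /=.
    by split=> //; rewrite Dz addrK (subvP TX).
  set u := iter n _ _ in nK nX *; rewrite rmulvE; split.
    by rewrite (subvP subalgebra_group_part) ?mem_mulv.
  have -> : eps - u ** z = (eps - u) ** eps + u ** b.
    have -> : u ** z = u ** eps - u ** b by rewrite Dz linearDr /= addrC addKr.
    by rewrite linearBl /= eps_id opprB [u ** b - _]addrC addrA.
  by apply: memvD; [apply: XrM | apply: XlM => //; apply: (subvP TX)].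
have [n zn] := jacobson_nilpotent charF0 mA subalgebra_group_part zJ.
by have [_] := modX n; rewrite zn subr0.
Qed.

End Component.
End Subgroup.

(** * Chains of components *)

Lemma sum_sqr_leq (I : finType) (a : I -> nat) :
  ((\sum_i a i) ^ 2 <= #|I| * \sum_i a i ^ 2)%N.
Proof.
rewrite -(leq_pmul2l (isT : (0 < 2)%N)).
have -> : (2 * (\sum_i a i) ^ 2 = \sum_i \sum_j 2 * (a i * a j))%N.
  rewrite -mulnn big_distrl big_distrr /=; apply: eq_bigr => i _.
  by rewrite big_distrr big_distrr.
have -> : (2 * (#|I| * \sum_i a i ^ 2) = \sum_i \sum_j (a i ^ 2 + a j ^ 2))%N.
  under [RHS]eq_bigr => i _ do rewrite big_split /= sum_nat_const.
  by rewrite big_split /= sum_nat_const -big_distrr /= addnn mul2n.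
by apply: leq_sum => i _; apply: leq_sum => j _; apply: nat_Cauchy.
Qed.

Section GradedDim.
Variables (F : fieldType) (A : vectType F) (m : {bilinear A -> A -> A}).
Variables (gT : finGroupType) (gr : gT -> {vspace A}).
Hypothesis grA : is_grading m gr.
Implicit Types (U : {vspace A}) (C : {set gT}).

Lemma dim_homogeneous_gpart U C : homogeneous gr U ->
  \dim (U :&: gpart gr C) = (\sum_(g in C) \dim (U :&: gr g))%N.
Proof.
move=> hU; have -> : (U :&: gpart gr C = \sum_(g in C) (U :&: gr g))%VS.
  apply/eqP; rewrite eqEsubv; apply/andP; split; last first.
    apply/subv_sumP => g gC; rewrite capvS //.
    by apply/subvP => x; apply: (gr_gpart grA).
  apply/subvP => x /memv_capP[xU /(gpartP grA) x0].
  rewrite -(hcomp_sum grA x) (bigID (mem C)) /= [X in _ + X]big1 // addr0.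
  by rewrite memv_sumr // => g _; rewrite memv_cap hU ?hcomp_mem.
apply: (directvP (S := \sum_(g in C) (U :&: gr g))%VS).
apply/directv_sum_independent => us usU us0 g gC.
have := congr1 (hcomp gr g) us0; rewrite linear0 linear_sum /= (bigD1 g) //=.
have [_ ug] := memv_capP (usU g gC).
rewrite (hcomp_id grA _ ug) eqxx big1 ?addr0 // => h /andP[hC hg].
have [_ uh] := memv_capP (usU h hC).
by rewrite (hcomp_id grA _ uh) eq_sym (negPf hg).
Qed.

(** Every g lies in hK for exactly |K| elements h. *)
Lemma sum_dim_lcoset U (K : {group gT}) : homogeneous gr U ->
  (\sum_(h : gT) \dim (U :&: gpart gr (h *: K)%g) = #|K| * \dim U)%N.
Proof.
move=> hU; have -> : \dim U = (\sum_(g : gT) \dim (U :&: gr g))%N.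
  rewrite -[X in \dim X]capvf -(gpart_setT grA) dim_homogeneous_gpart //.
  by apply: eq_bigl => g; rewrite inE.
under eq_bigr => h _ do rewrite dim_homogeneous_gpart // big_mkcond /=.
rewrite exchange_big big_distrr /=; apply: eq_bigr => g _.
rewrite -big_mkcond /= sum_nat_const; congr (_ * _)%N.
rewrite -(card_lcoset K g); apply: eq_card => h; rewrite -[LHS]/(g \in h *: K)%g.
by rewrite !mem_lcoset -groupV invMg invgK.
Qed.

End GradedDim.

Section Path.
Variables (F : closedFieldType) (A : vectType F) (m : {bilinear A -> A -> A}).
Variables (gT : finGroupType) (gr : gT -> {vspace A}).
Hypothesis charF0 : [pchar F] =i pred0.
Hypothesis mA : associative m.
Hypothesis grA : is_grading m gr.
Local Notation "x ** y" := (m x y) (at level 40, left associativity).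
Local Notation gpart := (gpart gr).
Implicit Types (I T U V W Z : {vspace A}) (x y z : A) (g h d : gT).

Local Notation J := (jacobson m fullv).

Let hJ : homogeneous gr J. Proof. exact: homogeneous_radical charF0 mA grA. Qed.
Let J_ideal x y : y \in J -> x ** y \in J /\ y ** x \in J.
Proof. exact: J_ideal. Qed.

Variables (S : {vspace A}) (Ts : seq {vspace A}).
Hypothesis wmS : graded_wedderburn_malcev m gr [set: gT]%G fullv S.
Hypothesis dS : graded_simple_decomposition m gr [set: gT]%G S Ts.
Local Notation n := (size Ts).
Local Notation R := (component Ts).

Let iR (i : 'I_n) : ideal_of m S (R i). Proof. by have [_ _ P] := dS; have [] := P i. Qed.
Let sR (i : 'I_n) : graded_simple m gr [set: gT]%G (R i).
Proof. by have [_ _ P] := dS; have [] := P i. Qed.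

Variable f : 'I_n -> A.
Hypothesis fP : forall i : 'I_n, graded_primitive m gr (R i) (f i).

Let f1 i : f i \in gr 1%g. Proof. by case: (fP i). Qed.
Let ff i : f i ** f i = f i. Proof. by case: (fP i). Qed.

(** A step x f_j of a path: the element x, its degree, and the index j. *)
Definition step : Type := (A * gT * 'I_n)%type.
Definition radical_step (p : step) := p.1.1 \in J /\ p.1.1 \in gr p.1.2.

(** The map z |-> z x_1 f_j1 x_2 f_j2 ... is bundled as an endomorphism, so that
    products of subspaces can be tested on products of elements. *)
Fixpoint path_map (ps : seq step) : 'End(A) :=
  if ps is p :: ps' then
    (path_map ps' \o (rmulv m (f p.2) \o rmulv m p.1.1))%VF else \1%VF.

Lemma path_map_cons p ps z : path_map (p :: ps) z = path_map ps (z ** p.1.1 ** f p.2).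
Proof. by rewrite !comp_lfunE !rmulvE. Qed.

Lemma path_mapM ps y z : path_map ps (y ** z) = y ** path_map ps z.
Proof.
elim: ps z => [|p ps IHps] z; first by rewrite !id_lfunE.
by rewrite !path_map_cons -IHps !mA.
Qed.

Definition primitive_product Z (w : seq 'I_n) : {vspace A} :=
  foldl (fun Z j => mulv m (mulv m Z J) <[f j]>%VS) Z w.

(** Each factor R_j is R_j f_j R_j, and the outer factors are absorbed by the
    neighbouring J. *)
Lemma component_product_sub w (i : 'I_n) Z U : (U <= mulv m Z (R i))%VS ->
  (foldl (fun U (j : 'I_n) => mulv m (mulv m U J) (R j)) U w
     <= mulv m (primitive_product Z w) (R (last i w)))%VS.
Proof.
elim: w i Z U => //= j w IHw i Z U UZ; apply: IHw.
apply/mulv_subP => y r yUJ rR.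
set X := mulv m _ (R j).
rewrite -lmulvE memv_preim; apply: (subvP _ _ rR).
apply: (mulv_RfR_sub mA grA (sR j) (fP j)) => r1 r2 r1R r2R.
rewrite -memv_preim lmulvE !mA; apply: mem_mulv => //.
apply: mem_mulv; last exact: memv_line.
rewrite -rmulvE memv_preim; apply: (subvP _ _ yUJ).
apply/mulv_subP => u x uU xJ; rewrite -memv_preim rmulvE -mA -rmulvE memv_preim.
apply: (subvP _ _ (subvP UZ _ uU)); apply/mulv_subP => z r0 zZ r0R.
rewrite -memv_preim rmulvE -mA mem_mulv //.
by have [_ xrJ] := J_ideal r1 xJ; have [] := J_ideal r0 xrJ.
Qed.

Lemma primitive_product_path w Z : primitive_product Z w <> 0%VS ->
  exists2 z, z \in Z & exists ps : seq step,
    [/\ [seq p.2 | p <- ps] = w, (forall p, p \in ps -> radical_step p)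
      & path_map ps z != 0].
Proof.
elim: w Z => [|j w IHw] Z /= Z0.
  exists (vpick Z); first exact: memv_pick.
  by exists [::]; split=> //; rewrite id_lfunE vpick0; apply/eqP.
have [z1 z1Z [ps [<- ps_good z1_neq0]]] := IHw _ Z0.
have [z [x [g [zZ xJ xg nz]]]] : exists z x g, [/\ z \in Z, x \in J, x \in gr g
    & path_map ps (z ** x ** f j) != 0].
  apply: contrapT => no; case/negP: z1_neq0; rewrite -memv_ker.
  apply: (subvP _ _ z1Z); apply/mulv_subP => y _ yZJ /vlineP[a ->].
  rewrite linearZr memvZ //= -rmulvE memv_preim; apply: (subvP _ _ yZJ).
  apply/mulv_subP => z x zZ xJ; rewrite -memv_preim rmulvE.
  rewrite -(hcomp_sum grA x) linear_sumr linear_sumlz memv_suml // => g _.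
  rewrite memv_ker; apply: contrapT => /negP nz; apply: no.
  by exists z, (hcomp gr g x), g; rewrite hJ ?hcomp_mem.
exists z => //; exists ((x, g, j) :: ps); split=> //.
  by move=> p; rewrite inE => /predU1P[->|/ps_good].
by rewrite path_map_cons.
Qed.

Lemma component_product_path i w : component_product m J i w <> 0%VS ->
  exists ps : seq step,
    [/\ [seq p.2 | p <- ps] = w, (forall p, p \in ps -> radical_step p)
      & path_map ps (f i) != 0].
Proof.
move=> CP0; pose Z := mulv m (R i) <[f i]>%VS.
have RZ : (R i <= mulv m Z (R i))%VS.
  by rewrite (simple_gen_primitive mA grA (sR i) (fP i)).
have CPsub := component_product_sub w RZ.
have [z zZ [ps [psw ps_good z0]]] : exists2 z, z \in Z & exists ps : seq step,
    [/\ [seq p.2 | p <- ps] = w, (forall p, p \in ps -> radical_step p)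
      & path_map ps z != 0].
  apply: primitive_product_path => Z0; apply: CP0; apply/eqP; rewrite -subv0.
  apply: subv_trans CPsub _; rewrite Z0; apply/mulv_subP => a b.
  by rewrite memv0 => /eqP -> _; rewrite linear0l mem0v.
exists ps; split=> //; apply: contra_neq z0 => f0.
suff <- : z ** f i = z by rewrite path_mapM f0 linear0r.
apply/eqP; rewrite -subr_eq0 -memv0.
have zE : z \in lker (rmulv m (f i) - \1)%VF.
  apply: (subvP _ _ zZ); apply/mulv_subP => r _ rR /vlineP[a ->].
  rewrite memv_ker add_lfunE opp_lfunE id_lfunE rmulvE subr_eq0.
  by rewrite linearZr linearZl_LR /= -mA ff.
by move: zE; rewrite memv_ker add_lfunE opp_lfunE id_lfunE rmulvE memv0.
Qed.

Variables (K : {group gT}) (S' : {vspace A}) (Ts' : seq {vspace A}).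
Local Notation AK := (gpart K).
Local Notation JK := (jacobson m AK).
Hypothesis wmS' : graded_wedderburn_malcev m gr K AK S'.
Hypothesis dS' : graded_simple_decomposition m gr K S' Ts'.
Local Notation n' := (size Ts').
Local Notation T := (component Ts').

Let JKE : JK = (J :&: AK)%VS. Proof. exact: jacobson_group_part. Qed.
Let mAK : subalgebra m AK. Proof. exact: subalgebra_group_part. Qed.
Let JK_ideal x y : x \in AK -> y \in JK -> x ** y \in JK /\ y ** x \in JK.
Proof. by move=> xK yJ; apply: jacobsonM xK yJ => //; apply: mAK. Qed.

Local Notation V i h := (rmod m (R i) (f i) :&: gpart (h *: K)%g)%VS.
Local Notation W i h := (lmod m (R i) (f i) :&: gpart (h *: K)^-1%g)%VS.

(** The component T_j of the chosen complement that corresponds to the coset hK and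
    the G-simple component R_i, with the data needed to connect it to a path. *)
Definition linked (i : 'I_n) h (j : 'I_n') :=
  [/\ \dim (T j) = \dim (mulv m (W i h) (V i h)),
      (T j <= R i + J)%VS &
      exists v w h1, [/\ h1 \in (h *: K)%g, v \in rmod m (R i) (f i) /\ v \in gr h1,
        w \in lmod m (R i) (f i) /\ w \in gr h1^-1%g, v ** w = f i &
        w ** v \in mulv m (mulv m AK (T j)) AK]].

Lemma exists_linked : exists tau : 'I_n -> gT -> option 'I_n',
  forall i h, if tau i h is Some j then linked i h j else V i h = 0%VS.
Proof.
have ex i h : exists o : option 'I_n',
    if o is Some j then linked i h j else V i h = 0%VS.
  have [V0|/eqP V0] := eqVneq (V i h) 0%VS; first by exists None.
  have [j jP] := component_correspondence charF0 mA grA wmS wmS' dS' (iR i) (sR i) (fP i) V0.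
  by exists (Some j).
have [tau tauP] := choice (fun ih : 'I_n * gT => ex ih.1 ih.2).
by exists (fun i h => tau (i, h)) => i h; apply: tauP (i, h).
Qed.

Variable tau : 'I_n -> gT -> option 'I_n'.
Hypothesis tauP :
  forall i h, if tau i h is Some j then linked i h j else V i h = 0%VS.

(** If T_j lies in R_i1 + J and in R_i2 + J with i1 != i2, it lies in J, because
    the sum of R_i1, R_i2 and J is direct; but T_j meets J only in 0. *)
Lemma tau_inj i1 i2 h1 h2 j : tau i1 h1 = Some j -> tau i2 h2 = Some j -> i1 = i2.
Proof.
move=> D1 D2; have := tauP i1 h1; have := tauP i2 h2; rewrite D1 D2.
move=> [_ T2 _] [_ T1 _]; apply: contrapT => /eqP i12.
have [_ _ T_simple] := dS'; have [[TS' _ _] [_ _ TT0 _]] := T_simple j.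
have [_ _ _ _ S'J0] := wmS'.
apply: TT0; apply/eqP; rewrite -subv0; apply/mulv_subP => t t' tT _.
suff -> : t = 0 by rewrite linear0l mem0v.
have /memv_addP[r1 r1R [y1 y1J Dt1]] := subvP T1 t tT.
have /memv_addP[r2 r2R [y2 y2J Dt2]] := subvP T2 t tT.
have r12 : r1 = r2.
  have [_ _ _ _ SJ0] := wmS.
  have [[R1S _ _] [R2S _ _]] := (iR i1, iR i2).
  apply/eqP; rewrite -subr_eq0 -memv0 -SJ0 memv_cap.
  rewrite memvB /=; [|exact: (subvP R1S)|exact: (subvP R2S)].
  have -> : r1 - r2 = y2 - y1.
    by apply/eqP; rewrite subr_eq addrAC eq_sym subr_eq addrC -Dt2 -Dt1.
  by rewrite memvB.
have r10 : r1 = 0.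
  have [_ dTs _] := dS; apply/eqP; rewrite -memv0.
  rewrite -(directv_sumP dTs i1 isT) memv_cap r1R r12 /=.
  by apply: (subvP (sumv_sup i2 _ (subvv _))) => //=; rewrite eq_sym.
have tJ : t \in J by rewrite Dt1 r10 add0r.
apply/eqP; rewrite -memv0 -S'J0 memv_cap (subvP TS') //= JKE memv_cap tJ.
have [_ _ _ S'JK _] := wmS'; rewrite -S'JK.
by apply: (subvP (addvSl _ _)); apply: (subvP TS').
Qed.

Section Coset.
Variable g0 : gT.

(** Each index on a path together with the degree of the part of the path that
    precedes it; d is the degree accumulated so far. *)
Fixpoint occurrences d (ps : seq step) : seq ('I_n * gT) :=
  if ps is p :: ps' then (p.2, (d * p.1.2)%g) :: occurrences (d * p.1.2)%g ps'
  else [::].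

(** The components of A_K that the coset g0 K selects along a path. *)
Definition active (occ : seq ('I_n * gT)) : seq 'I_n' :=
  pmap (fun id => tau id.1 (id.2^-1 * g0)%g) occ.

(** A prefix z of degree d of a path factors as u t, where u ends in the product
    of the components Y met so far, and t is the part of the path after the last
    of them; the degree of t is such that a right factor of degree in d^-1 g0 K
    brings it into A_K. *)
Definition realized (Y : seq 'I_n') d z : Prop :=
  Y = [::] \/ exists j w u t, [/\ Y = j :: w, z = u ** t,
    u \in mulv m (mulv m fullv (component_product m JK j w)) AK &
    t \in gpart (((d^-1 * g0) *: K)^-1)%g].

Lemma absorb_product U T0 u y e :
    u \in mulv m (mulv m fullv U) AK -> y \in JK -> e \in mulv m (mulv m AK T0) AK ->
  u ** y ** e \in mulv m (mulv m fullv (mulv m (mulv m U JK) T0)) AK.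
Proof.
move=> uX yJ eX; rewrite -lmulvE memv_preim; apply: (subvP _ _ eX).
apply/mulv_subP => bt c btX cK; rewrite -memv_preim lmulvE mA; apply: mem_mulv => //.
rewrite -lmulvE memv_preim; apply: (subvP _ _ btX); apply/mulv_subP => b t bK tT.
have [_ ybJ] := JK_ideal bK yJ.
rewrite -memv_preim lmulvE mA -(mA u y b) -mA -rmulvE memv_preim.
apply: (subvP _ _ uX); apply/mulv_subP => xp c' xpX c'K.
have [cybJ _] := JK_ideal c'K ybJ.
rewrite -memv_preim rmulvE -(mA xp c') (mA c') -rmulvE memv_preim.
apply: (subvP _ _ xpX); apply/mulv_subP => x p _ pU.
rewrite -memv_preim rmulvE -(mA x p); apply: mem_mulv; first exact: memvf.
by rewrite (mA p); do 2!apply: mem_mulv => //.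
Qed.

(** With the idempotent eps = w v of T_j and v w = f_i, one has z = z f_i f_i =
    (u (t v) eps) w; here t v lies in the radical of A_K, and w is the new tail. *)
Lemma realized_occurrence Y d z i j :
    tau i (d^-1 * g0)%g = Some j -> z ** f i = z ->
    (Y = [::] \/ exists j1 w u t, [/\ Y = j1 :: w, z = u ** t,
      u \in mulv m (mulv m fullv (component_product m JK j1 w)) AK,
      t \in J & t \in gpart (((d^-1 * g0) *: K)^-1)%g]) ->
  realized (rcons Y j) d z.
Proof.
move=> Dj zf; have := tauP i (d^-1 * g0)%g; rewrite Dj.
case=> _ _ [v [w [h1 [h1K [vr vg] [wl wg] vw epsX]]]] D; right.
have wK : w \in gpart (((d^-1 * g0) *: K)^-1)%g.
  by apply: (gr_gpart grA _ wg); rewrite mem_invg invgK.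
have zE : z ** v ** w ** v ** w = z by rewrite -(mA z v w) vw zf -mA vw zf.
case: D => [->|[j1 [ws [u [t [-> Dz uX tJ tK]]]]]].
  exists j, [::], (z ** v ** (w ** v)), w; split=> //; first by rewrite !mA zE.
  rewrite /component_product /= -lmulvE memv_preim; apply: (subvP _ _ epsX).
  apply/mulv_subP => b c bX cK; rewrite -memv_preim lmulvE mA; apply: mem_mulv => //.
  rewrite -lmulvE memv_preim; apply: (subvP _ _ bX); apply/mulv_subP => b1 b2 _ b2T.
  by rewrite -memv_preim lmulvE mA mem_mulv ?memvf.
exists j1, (rcons ws j), (u ** (t ** v) ** (w ** v)), w; split=> //.
  by rewrite !mA -Dz zE.
rewrite /component_product foldl_rcons; apply: absorb_product => //.
rewrite JKE memv_cap; have [_ -> /=] := J_ideal v tJ.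
apply: (gpartM grA _ tK (gr_gpart grA h1K vg)); exact: lcosetV_mul.
Qed.

Lemma realized_path ps Y d z :
    (forall p, p \in ps -> radical_step p) -> realized Y d z ->
  exists d', realized (Y ++ active (occurrences d ps)) d' (path_map ps z).
Proof.
elim: ps Y d z => [|[[x g] j] ps IHps] Y d z ps_good Yz.
  by exists d; rewrite cats0 id_lfunE.
have [xJ xg] : x \in J /\ x \in gr g := ps_good _ (mem_head _ _).
have ps_good' p : p \in ps -> radical_step p.
  by move=> pps; apply: ps_good; rewrite inE pps orbT.
rewrite path_map_cons /=; set z1 := _ ** f j; set d1 := (d * g)%g.
have z1f : z1 ** f j = z1 by rewrite -mA ff.
have {}Yz : Y = [::] \/ exists j1 w u t, [/\ Y = j1 :: w, z1 = u ** t,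
      u \in mulv m (mulv m fullv (component_product m JK j1 w)) AK,
      t \in J & t \in gpart (((d1^-1 * g0) *: K)^-1)%g].
  case: Yz => [->|[j1 [w [u [t [DY Dz uX tK]]]]]]; first by left.
  have txK : t ** x \in gpart (((d1^-1 * g0) *: K)^-1)%g.
    apply: (gpartM grA _ tK (gr_gpart grA (set11 g) xg)) => g1 g2 g1K /set1P->.
    by move: g1K; rewrite !mem_invg !mem_lcoset !invMg !invgK !mulgA mulgK.
  right; exists j1, w, u, (t ** x ** f j); split=> //; first by rewrite /z1 Dz !mA.
    by have [txJ _] := J_ideal t xJ; have [_] := J_ideal (f j) txJ.
  apply: (gpartM grA _ txK (gr_gpart grA (set11 1%g) (f1 j))) => g1 g2 g1K /set1P->.
  by rewrite mulg1.
rewrite /active /=; case Dj: (tau j (d1^-1 * g0)%g) => [j'|] /=; last first.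
  apply: IHps => //; case: Yz => [|[j1 [w [u [t [DY Dz uX _ tK]]]]]]; first by left.
  by right; exists j1, w, u, t.
rewrite -cat_rcons; apply: IHps => //.
exact: realized_occurrence Dj z1f Yz.
Qed.

End Coset.

Local Notation q := #|[set: gT] : K|%g.

Definition linked_dim i h := if tau i h is Some j then \dim (T j) else 0%N.

(** Cauchy-Schwarz for the dimensions of the spaces V i h, h in G, combined with
    the two bounds that involve dim D; the factor dim D cancels. *)
Lemma dim_component_linked (i : 'I_n) :
  (#|K| * \dim (R i) <= q * \sum_h linked_dim i h)%N.
Proof.
pose D := corner m (R i) (f i); pose N := \dim (rmod m (R i) (f i)).
have D_gt0 : (0 < \dim D)%N.
  have [fR _ _ f0 _] := fP i.
  rewrite lt0n dimv_eq0; apply: contra_neq f0 => D0; apply/eqP.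
  rewrite -memv0 -D0 memv_cap.
  by apply/andP; split; [apply/(rmodP mA (sR i) (fP i)) | apply/(lmodP mA (sR i) (fP i))].
have GE : #|gT| = (#|K| * q)%N by rewrite (Lagrange (subsetT K)) cardsT.
have low h : (\dim (V i h) ^ 2 <= \dim D * linked_dim i h)%N.
  have := tauP i h; rewrite /linked_dim; case: (tau i h) => [j [-> _ _]|->].
    exact: (corner_dim_lower mA grA (sR i) (fP i)).
  by rewrite dimv0.
rewrite -(leq_pmul2l D_gt0) -(leq_pmul2l (cardG_gt0 K)).
apply: (@leq_trans ((\sum_h \dim (V i h)) ^ 2)%N).
  rewrite (sum_dim_lcoset grA); last exact: (homogeneous_rmod grA (sR i) (fP i)).
  rewrite expnMn -mulnn -!mulnA leq_mul2l mulnCA leq_mul2l.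
  by rewrite (corner_dim_upper mA grA (sR i) (fP i)) !orbT.
apply: leq_trans (sum_sqr_leq _) _; rewrite GE -!mulnA leq_mul2l mulnCA leq_mul2l.
by apply/orP; right; apply/orP; right; rewrite big_distrr leq_sum.
Qed.

Lemma dim_appear_together (X : {set 'I_n}) : appear_together m J X ->
  (\sum_(i in X) \dim (R i) <= q ^ 2 * exp_of_components m JK Ts')%N.
Proof.
case=> i0 [w [CP0 DX]]; set E := exp_of_components _ _ _.
have [ps [psw ps_good nz]] := component_product_path CP0.
pose occ := (i0, 1%g) :: occurrences 1%g ps.
have occE : [seq o.1 | o <- occ] = i0 :: w.
  rewrite /= -psw; congr (_ :: _); move: (1%g : gT).
  by elim: (ps) => //= p ps' IHps d; rewrite IHps.
(* A component that occurs several times is represented by one occurrence, chosen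
   independently of the coset. *)
have occX i : exists d, i \in X -> (i, d) \in occ.
  have [iX|iX] := boolP (i \in X); last by exists 1%g.
  move: iX; rewrite DX inE -occE => /mapP[[i' d] o_occ ->].
  by exists d.
have [dd ddP] := choice occX.
have one_coset g0 : (\sum_(i in X) linked_dim i ((dd i)^-1 * g0)%g <= E)%N.
  pose Y := active g0 occ.
  have tauY i j : i \in X -> tau i ((dd i)^-1 * g0)%g = Some j -> j \in Y.
    move=> iX Dj; rewrite mem_pmap; apply/mapP; exists (i, dd i); first exact: ddP.
    by rewrite Dj.
  apply: (@leq_trans (\sum_(j in [set j in Y]) \dim (T j))%N).
    have linkE i : i \in X -> linked_dim i ((dd i)^-1 * g0)%g =
        (\sum_(j in [set j in Y]) (tau i ((dd i)^-1 * g0)%g == Some j) * \dim (T j))%N.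
      move=> iX; rewrite /linked_dim; case Dj: (tau _ _) => [j|]; last by rewrite big1.
      rewrite (bigD1 j) /= ?inE ?(tauY i) // eqxx mul1n big1 ?addn0 // => k /andP[_ kj].
      by rewrite (inj_eq Some_inj) eq_sym (negPf kj).
    rewrite (eq_bigr _ linkE) exchange_big /=; apply: leq_sum => j _.
    rewrite -big_distrl /= -[X in (_ <= X)%N]mul1n leq_mul2r; apply/orP; right.
    have [[i /andP[iX /eqP Dj]]|no] :=
        pselect (exists i, (i \in X) && (tau i ((dd i)^-1 * g0)%g == Some j)).
      rewrite (bigD1 i) //= Dj eqxx big1 // => k /andP[_ ki]; apply/eqP.
      by rewrite eqb0; apply: contra ki => /eqP Dk; rewrite (tau_inj Dk Dj).
    rewrite big1 // => i iX; apply/eqP; rewrite eqb0; apply/negP => Dj.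
    by apply: no; exists i; rewrite iX.
  have [d' realY] : exists d', realized g0 Y d' (path_map ps (f i0)).
    have -> : Y = active g0 [:: (i0, 1%g)] ++ active g0 (occurrences 1%g ps).
      by rewrite -pmap_cat.
    apply: realized_path ps_good _; rewrite /active /=.
    case Dj: (tau _ _) => [j|]; last by left.
    by apply: (realized_occurrence (Y := [::]) Dj); [apply: ff | left].
  case: realY => [->|[j0 [w' [u [t [DY Dz uX _]]]]]].
    by rewrite big1 // => j; rewrite inE.
  apply: (leq_bigmax_cond (F := fun Z : {set 'I_n'} => \sum_(j in Z) \dim (T j))%N).
  apply/asboolP; exists j0, w'; split; last by rewrite DY.
  move=> CP'0; case/eqP: nz; rewrite Dz.
  suff -> : u = 0 by rewrite linear0l.
  apply/eqP; rewrite -memv0; apply: (subvP _ _ uX); apply/mulv_subP => x a xCP _.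
  suff -> : x = 0 by rewrite linear0l mem0v.
  apply/eqP; rewrite -memv0; apply: (subvP _ _ xCP); apply/mulv_subP => y c _.
  by rewrite CP'0 memv0 => /eqP ->; rewrite linear0r mem0v.
rewrite -(leq_pmul2l (cardG_gt0 K)) big_distrr /=.
apply: (@leq_trans (\sum_(i in X) q * \sum_h linked_dim i h)%N).
  by apply: leq_sum => i _; apply: dim_component_linked.
have -> : (#|K| * (q ^ 2 * E) = q * (#|gT| * E))%N.
  by rewrite -cardsT -(Lagrange (subsetT K)) -mulnn !mulnA [(#|K| * q)%N]mulnC -!mulnA.
rewrite -big_distrr leq_mul2l; apply/orP; right.
under eq_bigr => i _ do rewrite (reindex_inj (mulgI (dd i)^-1%g)).
rewrite exchange_big -sum_nat_const; apply: leq_sum => g0 _.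
exact: one_coset.
Qed.

End Path.

(** * The inequality *)

Lemma exp_conj_spec (F : fieldType) (A : vectType F) (m : {bilinear A -> A -> A})
    (gT : finGroupType) (gr : gT -> {vspace A}) (H : {group gT}) (B : {vspace A}) :
  exists S Ts, [/\ exp_conj m gr H B = exp_of_components m (jacobson m B) Ts,
    graded_wedderburn_malcev m gr H B S \/ S = 0%VS,
    (exists S0, graded_wedderburn_malcev m gr H B S0) ->
      graded_wedderburn_malcev m gr H B S,
    graded_simple_decomposition m gr H S Ts \/ Ts = [::] &
    (exists Ts0, graded_simple_decomposition m gr H S Ts0) ->
      graded_simple_decomposition m gr H S Ts].
Proof.
eexists; eexists; split; first by [].
- have [exS|noS] := pselect (exists S, graded_wedderburn_malcev m gr H B S).
    by left; apply: (classical_sets.xgetPex 0%VS exS).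
  by right; apply: classical_sets.xgetPN => S wmS; apply: noS; exists S.
- by move=> exS; apply: (classical_sets.xgetPex 0%VS exS).
- set S := classical_sets.xget 0%VS _.
  have [exTs|noTs] := pselect (exists Ts, graded_simple_decomposition m gr H S Ts).
    by left; apply: (classical_sets.xgetPex [::] exTs).
  by right; apply: classical_sets.xgetPN => Ts dTs; apply: noTs; exists Ts.
by move=> exTs; apply: (classical_sets.xgetPex [::] exTs).
Qed.

Theorem theorem2p10 (F : closedFieldType) (charF0 : [pchar F] =i pred0)
    (gT : finGroupType) (A : vectType F) (m : {bilinear A -> A -> A})
    (mA : associative m) (gr : gT -> {vspace A}) (grA : is_grading m gr)
    (K : {group gT}) :
  (exp_conj m gr [set: gT]%G fullv
     <= #|[set: gT] : K|%g ^ 2 * exp_conj m gr K (graded_part gr K))%N.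
Proof.
have [S [Ts [-> wmS0 _ dS0 _]]] := exp_conj_spec m gr [set: gT]%G fullv.
have [S' [Ts' [-> _ wmS' _ dS']]] := exp_conj_spec m gr K (graded_part gr K).
apply/bigmax_leqP => X /asboolP XX.
(* The default values S = 0 and Ts = [::] admit no nonzero product. *)
have dS : graded_simple_decomposition m gr [set: gT]%G S Ts.
  by case: dS0 => // Ts0; exfalso; move: X XX; rewrite Ts0 => X [[]].
have wmS : graded_wedderburn_malcev m gr [set: gT]%G fullv S.
  case: wmS0 => // S0.
  have [i _] := XX; have [_ _ /(_ i)[[TS _ _] [_ _ TT0 _]]] := dS.
  case: TT0; apply/eqP; rewrite -subv0; apply/mulv_subP => x y xT _.
  have := subvP TS x xT; rewrite S0 memv0 => /eqP ->.
  by rewrite linear0l mem0v.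
have {}wmS' : graded_wedderburn_malcev m gr K (gpart gr K) S'.
  apply: wmS'; exists (S :&: gpart gr K)%VS.
  exact: graded_wedderburn_malcev_subgroup.
have {}dS' : graded_simple_decomposition m gr K S' Ts'.
  have [mS' gS' ssS' _ _] := wmS'; apply: dS'.
  have iS' : ideal_of m S' S' by split.
  have [hS' _] := (gradedP grA K S').1 gS'.
  have [Us UsP] := graded_ideal_decomposition charF0 mA grA mS' gS' ssS' iS' hS'.
  by exists Us.
have [_ _ sR] := dS.
have [f fP] := choice (fun i => exists_graded_primitive mA grA (sR i).2).
have [tau tauP] := exists_linked charF0 mA grA wmS dS fP wmS' dS'.
exact: (dim_appear_together charF0 mA grA wmS dS fP wmS' dS' tauP XX).
Qed.
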